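(* Let $(X,d,\mu)$ be a complete metric measure space, with $\mu$ a doubling measure, supporting a $(1,1)$-Poincaré inequality, and let $\kappa\in(0,1)$. Then there exist constants $\tau\ge1$ and $C\ge1$, depending only on $\kappa$ and the doubling and $(1,1)$-Poincaré inequality constants, such that for any $\mu$-measurable set $U\subset X$ and any ball $B_0=B(x_0,r_0)\subset X$ satisfying $$\frac{\mu(U\cap B_0)}{\mu(B_0)}\le\kappa,$$ there exist a countable collection of pairwise disjoint balls $\{B_i\}_{i\in I}$, $I\subset\mathbb N$, with radii $r_i=\mathrm{rad}(B_i)=2^{-N_i}r_0$ for some $N_i\in\mathbb N\cup\{0\}$, and a set $\mathcal N\subset U$ with $\mu(\mathcal N)=0$, such that $$U\cap B_0\subset\mathcal N\cup\bigcup_{i\in I}5\tau B_i\quad\text{and}\quad\bigcup_{i\in I}B_i\subset\tau B_0,$$ and for all $0<\theta<1$, $$\sum_{i\in I}\frac{\mu(B_i)}{r_i^\theta}\le C(1-\theta)\,P_\theta(U\cap B_0,\tau B_0).$$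
   Context: A metric measure space $(X,d,\mu)$ is a metric space with a Borel regular outer measure $\mu$. Balls $B(x,r)=\{y\in X:d(x,y)<r\}$ are open and come with a prescribed center and radius; for $B=B(x,r)$, $\lambda B:=B(x,\lambda r)$ and $\mathrm{rad}(B):=r$. The measure $\mu$ is doubling with constant $C_\mu\ge1$ if $0<\mu(B(x,2r))\le C_\mu\,\mu(B(x,r))<\infty$ for all $x\in X$, $r>0$. We write $u_B=\frac1{\mu(B)}\int_B u\,d\mu$. A Borel function $g:X\to[0,\infty]$ is an upper gradient of $u:X\to[-\infty,\infty]$ if $|u(\gamma(b))-u(\gamma(a))|\le\int_\gamma g\,ds$ for all non-constant compact rectifiable curves $\gamma:[a,b]\to X$ (with $\int_\gamma g\,ds=\infty$ required if $u(\gamma(a))$ or $u(\gamma(b))$ is not finite). $(X,d,\mu)$ supports a $(1,1)$-Poincaré inequality if there are constants $C_P,\tau_P\ge1$ such that $\frac1{\mu(B)}\int_B|u-u_B|\,d\mu\le C_P\,\mathrm{rad}(B)\,\frac1{\mu(\tau_PB)}\int_{\tau_PB}g\,d\mu$ for every ball $B$, every $u\in L^1_{\mathrm{loc}}(X)$ and every upper gradient $g$ of $u$. For $0<\theta<1$, measurable $E\subset X$ and open $\Omega\subset X$, the fractional $\theta$-perimeter is $$P_\theta(E,\Omega)=\int_{\Omega\cap E}\int_{\Omega\setminus E}\frac{2}{d(x,y)^\theta[\mu(B(x,d(x,y)))+\mu(B(y,d(x,y)))]}\,d\mu(y)\,d\mu(x).$$ *)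

(* Defs.v *)
From HB Require Import structures.
From mathcomp Require Import all_boot all_order all_algebra.
From mathcomp Require Import all_classical all_reals all_analysis.
From mathcomp Require Import measurable_realfun.

Set Implicit Arguments.
Unset Strict Implicit.
Unset Printing Implicit Defensive.

Import Order.TTheory GRing.Theory Num.Theory.
Import numFieldNormedType.Exports.

Local Open Scope classical_set_scope.
Local Open Scope ring_scope.

(* A base point is needed only because measurableType's are pointed in the
   library; it plays no role below. *)
#[short(type="pointedMetricType")]
HB.structure Definition PointedMetric (R : numDomainType) :=
  {T of Metric R T & isPointed T}.

#[short(type="completeMetricType")]
HB.structure Definition CompleteMetric (R : numDomainType) :=
  {T of PointedMetric R T & Complete T}.

Section metric_measure.
Variables (R : realType) (X : pointedMetricType R).
Variable mu : {outer_measure set X -> \bar R}.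
Local Open Scope ereal_scope.

Definition borel_regular :=
  (forall A, <<s open >> A -> mu.-caratheodory A) /\
  (forall A, exists B, [/\ <<s open >> B, A `<=` B & mu B = mu A]).

(* mu, as a measure on the sigma-algebra of its Caratheodory measurable sets *)
Definition cara_measure : {measure set (caratheodory_type mu) -> \bar R} :=
  (mu : set (caratheodory_type mu) -> \bar R).

Definition doubling (Cmu : R) :=
  (1 <= Cmu)%R /\
  forall (x : X) (r : R), (0 < r)%R ->
    [/\ 0 < mu (ball x (2 * r)),
        mu (ball x (2 * r)) <= Cmu%:E * mu (ball x r) &
        Cmu%:E * mu (ball x r) < +oo].

Definition average (B : set X) (f : X -> \bar R) : \bar R :=
  (\int[cara_measure]_(x in B) f x) / mu B.

Definition locally_integrable_mu (u : X -> \bar R) :=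
  forall x : X, exists2 r : R, (0 < r)%R &
    cara_measure.-integrable (ball x r) u.

Definition theta_perimeter (theta : R) (E Omega : set X) : \bar R :=
  \int[cara_measure]_(x in Omega `&` E)
    \int[cara_measure]_(y in Omega `\` E)
      (2%:E / ((mdist (x : X) (y : X) `^ theta)%:E *
         (mu (ball (x : X) (mdist (x : X) (y : X))) +
          mu (ball (y : X) (mdist (x : X) (y : X)))))).

End metric_measure.

Section curves.
Variables (R : realType) (X : pointedMetricType R).
Implicit Types (gamma : R -> X) (a b : R).

Definition curve_variation a b gamma (s : seq R) : R :=
  let F := gamma \o nth b (a :: s) in
  \sum_(0 <= n < size s) mdist (F n) (F n.+1).

Definition curve_length a b gamma : \bar R :=
  ereal_sup [set (curve_variation a b gamma s)%:E | s in itv_partition a b].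

Definition rectifiable_curve a b gamma :=
  [/\ a < b, {within `[a, b], continuous gamma} &
      (curve_length a b gamma < +oo)%E].

(* The arc-length parametrization: its value at s is gamma t, for any t such
   that gamma has length s on [a, t]; gamma t does not depend on that choice. *)
Definition arc_param a b gamma (s : R) : X :=
  gamma (xget a [set t | t \in `[a, b] /\ curve_length a t gamma = s%:E]).

Definition line_integral a b gamma (g : X -> \bar R) : \bar R :=
  (\int[lebesgue_measure]_(s in `[0%R, fine (curve_length a b gamma)])
     g (arc_param a b gamma s))%E.

Definition upper_gradient (u g : X -> \bar R) :=
  [/\ measurable_fun [set: g_sigma_algebraType (@open X)] g,
      (forall x, (0 <= g x)%E) &
      forall a b gamma, rectifiable_curve a b gamma ->
        (exists2 t, t \in `[a, b] & gamma t <> gamma a) ->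
        (u (gamma a) \is a fin_num -> u (gamma b) \is a fin_num ->
          (`|u (gamma b) - u (gamma a)| <= line_integral a b gamma g)%E) /\
        (u (gamma a) \isn't a fin_num \/ u (gamma b) \isn't a fin_num ->
          line_integral a b gamma g = +oo%E)].

Definition poincare11 (mu : {outer_measure set X -> \bar R}) (CP tauP : R) :=
  [/\ 1 <= CP, 1 <= tauP &
      forall (x : X) (r : R), 0 < r ->
      forall u g : X -> \bar R,
        locally_integrable_mu mu u -> upper_gradient u g ->
        (average mu (ball x r)
           (fun y => `|u y - average mu (ball x r) u|)
         <= (CP * r)%:E * average mu (ball x (tauP * r)) g)%E].

End curves.

(* Main.v *)
Require Import Defs.
From HB Require Import structures.
From mathcomp Require Import all_boot all_order all_algebra.
From mathcomp Require Import finmap.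
From mathcomp Require Import all_classical all_reals all_analysis.
From mathcomp Require Import measurable_realfun ring lra.

Set Implicit Arguments.
Unset Strict Implicit.
Unset Printing Implicit Defensive.

Import Order.TTheory GRing.Theory Num.Theory.
Import numFieldNormedType.Exports.

Local Open Scope classical_set_scope.
Local Open Scope ring_scope.

(* Let E be U intersected with B0 and stop, around almost every point of E, at the largest dyadic
   ball in which E has density larger than a small constant; a covering argument
   shows that the points without such a ball form a null set.  In the doubled
   stopping ball B(x, 2 rho) both E and its complement have density bounded below.
   Fix t <= rho and let G be the set of points near which, at scale t, the
   complement of E has small density.  A cutoff function of slope 1/t of G
   approximates the indicator of E, and the Poincare inequality applied to it
   shows that the layer of points of E at distance O(t) from the complement of G
   has measure at least c (t / rho) mu(B(x, rho)).  For a point z of that layer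
   the inner integral of the perimeter is at least c t^-theta.  Summing over
   t = 2^-j rho, the inner integral controls a geometric sum dominated by its last
   term, while the layers contribute rho^-theta mu(B) times the sum of
   2^(-j (1 - theta)), which is comparable to 1 / (1 - theta).  All covering
   arguments are of Vitali type, and integrals are only bounded from below by
   simple functions, so that no measurability of the kernel is needed. *)

(** * Lower bounds for integrals of functions not known to be measurable *)

Section lower_integral.
Context d (T : measurableType d) (R : realType).
Variable mu : {measure set T -> \bar R}.
Local Open Scope ereal_scope.

Import HBNNSimple.

(** The integral of a nonnegative function is a supremum over the simple functions below it, and a
    larger function has more of them; measurability never enters. *)
Lemma le_integral_nonmeasurable (D : set T) (f g : T -> \bar R) :
  (forall x, D x -> 0 <= f x) -> (forall x, D x -> f x <= g x) ->
  \int[mu]_(x in D) f x <= \int[mu]_(x in D) g x.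
Proof.
move=> f0 fg; rewrite !ge0_integralE//; last first.
  by move=> x Dx; exact: le_trans (f0 _ Dx) (fg _ Dx).
apply: ereal_sup_le => _ /= [h hf <-]; exists h => // x.
apply: le_trans (hf x) _.
by rewrite /patch; case: ifP => // /set_mem; exact: fg.
Qed.

(** The simple function on the left is integrated exactly and monotonicity does the rest. Line
    integrals and the outer integral of the perimeter are both bounded from below in this way. *)
Lemma sum_indic_le_integral (I : eqType) (s : seq I) (c : I -> R)
    (A : I -> set T) (D : set T) (f : T -> \bar R) :
  measurable D -> (forall i, measurable (A i)) ->
  (forall i, (0 <= c i)%R) ->
  (forall x, D x -> (\sum_(i <- s) c i * \1_(A i) x)%:E <= f x) ->
  \sum_(i <- s) (c i)%:E * mu (A i `&` D) <= \int[mu]_(x in D) f x.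
Proof.
move=> mD mA c0 sf.
apply: (@le_trans _ _ (\int[mu]_(x in D) (\sum_(i <- s) c i * \1_(A i) x)%:E)).
  rewrite le_eqVlt; apply/orP; left; apply/eqP; apply: esym.
  under eq_integral do rewrite -sumEFin.
  rewrite ge0_integral_sum//; last 2 first.
  - move=> i; apply/measurable_EFinP; exact: measurable_funM.
  - by move=> i x _; rewrite lee_fin mulr_ge0.
  apply: eq_bigr => i _; under eq_integral do rewrite EFinM.
  rewrite ge0_integralZl//.
  - by rewrite integral_indic.
  - by apply/measurable_EFinP; exact: measurable_indic.
  by rewrite lee_fin.
apply: le_integral_nonmeasurable => // x Dx; rewrite lee_fin.
by apply: sumr_ge0 => i _; rewrite mulr_ge0.
Qed.

Lemma cst_indic_le_integral (c : R) (A D : set T) (f : T -> \bar R) :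
  measurable D -> measurable A -> A `<=` D -> (0 <= c)%R ->
  (forall x, D x -> 0 <= f x) -> (forall x, A x -> c%:E <= f x) ->
  c%:E * mu A <= \int[mu]_(x in D) f x.
Proof.
move=> mD mA AD c0 f0 cf.
have := @sum_indic_le_integral _ [:: tt] (fun=> c) (fun=> A) D f mD.
rewrite big_seq1 (setIidl AD); apply => // x Dx.
rewrite big_seq1 indicE; have [/set_mem Ax|_] := boolP (x \in A).
  by rewrite mulr1 cf.
by rewrite mulr0 f0.
Qed.

End lower_integral.

(** At most one summand survives. This serves simple functions whose pieces live on disjoint
    intervals or in disjoint balls. *)
Lemma sum_single_le (R : realType) (I : eqType) (s : seq I) (F : I -> R)
    (M : \bar R) : uniq s -> (0 <= M)%E ->
  (forall i j, i \in s -> j \in s -> F i != 0 -> F j != 0 -> i = j) ->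
  (forall i, i \in s -> (F i)%:E <= M)%E -> ((\sum_(i <- s) F i)%:E <= M)%E.
Proof.
move=> us M0 single FM.
have [/hasP[i si Fi0]|/hasPn allF] := boolP (has (fun i => F i != 0) s).
  rewrite (bigD1_seq i)//= big_seq_cond big1 ?addr0 ?FM//.
  move=> j /andP[sj ji]; apply/eqP; apply: contraTT ji => Fj0.
  by rewrite negbK; apply/eqP; exact: single.
by rewrite big_seq big1// => i /allF; rewrite negbK => /eqP.
Qed.

(** * Curve length and upper gradients *)

Section curve_length.
Context (R : realType) (X : pointedMetricType R).
Variable gamma : R -> X.
Implicit Types (a b c t : R) (s : seq R).

(** A recursive form of [curve_variation], suited to induction on the partition and to
    concatenation. *)
Fixpoint polygon_length (a : R) (s : seq R) : R :=
  if s is x :: s' then mdist (gamma a) (gamma x) + polygon_length x s' else 0.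

Lemma polygon_length_cat a s1 s2 : polygon_length a (s1 ++ s2) =
  polygon_length a s1 + polygon_length (last a s1) s2.
Proof. by elim: s1 a => [a|x s ih a] /=; rewrite ?add0r// ih addrA. Qed.

Lemma curve_variationE a b s : curve_variation a b gamma s = polygon_length a s.
Proof.
rewrite /curve_variation; elim: s a => [|x s ih] a /=; first by rewrite big_nil.
by rewrite big_nat_recl//= -(ih x).
Qed.

Local Open Scope ereal_scope.

Lemma polygon_length_le a b s : itv_partition a b s ->
  (polygon_length a s)%:E <= curve_length a b gamma.
Proof.
by move=> abs; apply: ereal_sup_ubound; exists s => //; rewrite curve_variationE.
Qed.

Lemma curve_length_le a b (M : \bar R) :
  (forall s, itv_partition a b s -> (polygon_length a s)%:E <= M) ->
  curve_length a b gamma <= M.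
Proof.
by move=> h; apply: ge_ereal_sup => _ /= [s abs <-]; rewrite curve_variationE h.
Qed.

Lemma curve_lengthxx a : curve_length a a gamma = 0.
Proof.
apply/eqP; rewrite eq_le; apply/andP; split.
  by apply: curve_length_le => s /itv_partitionxx ->.
by have := @polygon_length_le a a [::]; apply; split => //=; rewrite eqxx.
Qed.

Lemma mdist_le_curve_length a b : (a <= b)%R ->
  (mdist (gamma a) (gamma b))%:E <= curve_length a b gamma.
Proof.
rewrite le_eqVlt => /predU1P[->|ab]; first by rewrite mdistxx curve_lengthxx.
have := @polygon_length_le a b [:: b]; rewrite /= addr0; apply.
exact: itv_partition1.
Qed.

Lemma curve_length_ge0 a b : (a <= b)%R -> 0 <= curve_length a b gamma.
Proof.
by move=> ab; apply: le_trans (mdist_le_curve_length ab); rewrite lee_fin mdist_ge0.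
Qed.

(** Partitions of the two halves concatenate to a partition of the whole. *)
Lemma curve_length_superadd a c b : (a <= c)%R -> (c <= b)%R ->
  curve_length a c gamma + curve_length c b gamma <= curve_length a b gamma.
Proof.
move=> ac cb.
have h s : itv_partition a c s ->
    (polygon_length a s)%:E + curve_length c b gamma <= curve_length a b gamma.
  move=> acs; rewrite -leeBrDl//; apply: curve_length_le => s' cbs.
  rewrite leeBrDl// -EFinD; case: (acs) => _ /eqP <-.
  rewrite -polygon_length_cat; apply: polygon_length_le.
  exact: itv_partition_cat acs cbs.
(* Moving a term across the inequality requires it to be finite; if the second length is infinite, a
   single partition of the first half already makes the whole length infinite. *)
have [lcb|] := boolP (curve_length c b gamma \is a fin_num).
  by rewrite -leeBrDr//; apply: curve_length_le => s acs; rewrite leeBrDr// h.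
rewrite ge0_fin_numE ?curve_length_ge0// -leNgt leye_eq => /eqP cboo.
have [s acs] : exists s, itv_partition a c s.
  move: ac; rewrite le_eqVlt => /predU1P[->|ac].
    by exists [::]; split => //=; rewrite eqxx.
  by exists [:: c]; exact: itv_partition1.
by have := h s acs; rewrite cboo addey// leye_eq => /eqP ->; rewrite leey.
Qed.

(** Induction on the partition: an edge ending at or before [c] is absorbed into the first length,
    and an edge straddling [c] is split there by the triangle inequality. *)
Lemma curve_length_subadd a c b : (a <= c)%R -> (c <= b)%R ->
  curve_length a b gamma <= curve_length a c gamma + curve_length c b gamma.
Proof.
move=> ac cb; apply: curve_length_le => s; elim: s a ac => [|x s ih] a ac.
  move=> _; rewrite adde_ge0// curve_length_ge0//.
move=> [/= /andP[ax xs] lb]; have [xc|cx] := leP x c.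
  rewrite EFinD; apply: le_trans (leeD2r _ (curve_length_superadd (ltW ax) xc)).
  rewrite -addeA leeD// ?mdist_le_curve_length ?(ltW ax)//.
  by apply: ih => //; split.
apply: (@le_trans _ _ ((mdist (gamma a) (gamma c))%:E +
    (polygon_length c (x :: s))%:E)).
  by rewrite -EFinD lee_fin /= addrA lerD2r metric_triangle.
rewrite leeD ?mdist_le_curve_length//.
by apply: polygon_length_le; split => //=; rewrite cx.
Qed.

Lemma curve_lengthD a c b : (a <= c)%R -> (c <= b)%R ->
  curve_length a b gamma = curve_length a c gamma + curve_length c b gamma.
Proof.
by move=> ac cb; apply/eqP; rewrite eq_le curve_length_subadd ?curve_length_superadd.
Qed.

Lemma within_continuous_mdist a b t (e : R) :
  {within `[a, b], continuous gamma} -> (t \in `[a, b])%R -> (0 < e)%R ->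
  exists2 d : R, (0 < d)%R & forall t', (t' \in `[a, b])%R -> (`|t - t'| < d)%R ->
    (mdist (gamma t) (gamma t') < e)%R.
Proof.
move=> /subspace_continuousP cg tab e0.
have /cvg_ballP/(_ _ e0) := cg t tab.
rewrite near_withinE => /nbhs_ballP[d /= d0 h].
exists d => // t' t'ab tt'.
by have := h t' tt' t'ab; rewrite ballEmdist.
Qed.

(* The supremum of the times at which the length is at most [l] works: length is
   lower semicontinuous because polygons are, and it is right continuous. *)
Lemma curve_length_attained a b (l : R) : rectifiable_curve a b gamma ->
  (0 <= l)%R -> l%:E <= curve_length a b gamma ->
  exists2 t, (t \in `[a, b])%R & curve_length a t gamma = l%:E.
Proof.
move=> [ab cg Loo] l0 lL.
pose A : set R := [set t | (t \in `[a, b])%R /\ curve_length a t gamma <= l%:E].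
have Aa : A a by split; rewrite ?in_itv/= ?lexx ?(ltW ab)// curve_lengthxx lee_fin.
have supA : has_sup A.
  split; first by exists a.
  by exists b => t [] /[!in_itv]/= /andP[].
set t0 := sup A.
have at0 : (a <= t0)%R by exact: sup_ubound supA.2 _ Aa.
have t0b : (t0 <= b)%R.
  by apply: sup_le_ub; [exists a|move=> t [] /[!in_itv]/= /andP[]].
have t0ab : (t0 \in `[a, b])%R by rewrite in_itv/= at0.
have fL t t' : (a <= t)%R -> (t <= t')%R -> (t' <= b)%R ->
    curve_length t t' gamma \is a fin_num.
  move=> a_t tt' t'b; rewrite ge0_fin_numE ?curve_length_ge0//.
  apply: le_lt_trans Loo; rewrite (curve_lengthD a_t (le_trans tt' t'b)).
  rewrite (curve_lengthD tt' t'b) addeCA leeDl// adde_ge0 ?curve_length_ge0//.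
have At0 : curve_length a t0 gamma <= l%:E.
  apply: curve_length_le => s; case/lastP: s => [_|s y]; first by rewrite lee_fin.
  move=> [] /[!rcons_path]/= /andP[sa sy] /[!last_rcons] /eqP yt0.
  rewrite {y}yt0 in sy *; apply/lee_addgt0Pr => e e0.
  have [d d0 hd] := within_continuous_mdist cg t0ab e0.
  (* The last vertex [t0] is moved to some [t1] in [A]: beyond the previous vertex, so that a
     partition remains, and within [d] of [t0], so that at most [e] of length is lost. *)
  have /(sup_gt supA.1)[t1 At1] : (Num.max (last a s) (t0 - d) < t0)%R.
    by rewrite gt_max sy ltrBlDr ltrDl.
  rewrite gt_max => /andP[st1 dt1].
  have t1t0 : (t1 <= t0)%R by exact: sup_ubound supA.2 _ At1.
  have [t1ab Lt1] := At1.
  apply: (@le_trans _ _ ((polygon_length a (rcons s t1))%:E + e%:E)); last first.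
    rewrite leeD2r//; apply: le_trans Lt1; apply: polygon_length_le.
    by split; rewrite ?rcons_path ?sa ?last_rcons.
  rewrite -!cats1 !polygon_length_cat/= !addr0 -EFinD lee_fin -addrA lerD2l.
  apply: le_trans (metric_triangle _ (gamma t1) _) _.
  rewrite lerD2l metric_sym ltW// hd//.
  by rewrite ger0_norm ?subr_ge0// ltrBlDr -ltrBlDl.
exists t0 => //; apply/eqP; rewrite eq_le At0/= leNgt; apply/negP => Ll.
have t0b' : (t0 < b)%R.
  by rewrite lt_neqAle t0b andbT; apply/eqP => E; move: Ll; rewrite E ltNge lL.
have fa : curve_length a t0 gamma \is a fin_num by exact: fL.
pose e := (l - fine (curve_length a t0 gamma))%R.
have e0 : (0 < e)%R by rewrite subr_gt0 -lte_fin fineK.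
have e20 : (0 < e / 2)%R by rewrite divr_gt0.
have fb : curve_length t0 b gamma \is a fin_num by exact: fL.
(* Right continuity: take a polygon on [[t0, b]] that misses less than [e / 2] of the length.
   Inserting a vertex [t'] close to [t0] before its first vertex shows that [[t0, t']] has length
   below [e], so [t'] is in [A] beyond the supremum. *)
have [_ /= [s [sp /eqP sl] <-]] : exists2 y,
    [set (curve_variation t0 b gamma s)%:E | s in itv_partition t0 b] y &
    curve_length t0 b gamma - (e / 2)%:E < y.
  by apply: ereal_sup_gt; rewrite lteBlDr// lteDl.
rewrite curve_variationE; case: s sp sl => [_ /= t0b''|x s].
  by rewrite t0b'' ltxx in t0b'.
move=> /= /andP[t0x xs] sl h.
have xb : (x <= b)%R by rewrite -sl; apply: (@itv_partition_le _ _ _ _ s); split.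
have [d d0 hd] := within_continuous_mdist cg t0ab e20.
pose t' := Num.min x (t0 + d / 2)%R.
have t0t' : (t0 < t')%R by rewrite lt_min t0x ltrDl divr_gt0.
have t'x : (t' <= x)%R by rewrite ge_min lexx.
have t'b : (t' <= b)%R by exact: le_trans xb.
have t'd : (t' < t0 + d)%R.
  by rewrite gt_min; apply/orP; right; rewrite ltrD2l ltr_pdivrMr// ltr_pMr// ltr1n.
have t'ab : (t' \in `[a, b])%R.
  by rewrite in_itv/= t'b andbT (le_trans at0)// ltW.
have dt' : (mdist (gamma t0) (gamma t') < e / 2)%R.
  by apply: hd => //; rewrite distrC ger0_norm ?subr_ge0 ?(ltW t0t')// ltrBlDl.
have f1 : curve_length t0 t' gamma \is a fin_num by apply: fL => //; exact: ltW.
have f2 : curve_length t' b gamma \is a fin_num.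
  by apply: fL => //; rewrite (le_trans at0)// ltW.
have Lt' : (mdist (gamma t') (gamma x) + polygon_length x s)%:E
    <= curve_length t' b gamma.
  rewrite (curve_lengthD t'x xb) EFinD leeD ?mdist_le_curve_length//.
  by apply: polygon_length_le; split => //; apply/eqP.
have : (t' <= t0)%R.
  apply: (sup_ubound supA.2); split => //.
  rewrite (curve_lengthD at0 (ltW t0t')).
  move: h Lt'; rewrite (curve_lengthD (ltW t0t') t'b).
  rewrite -(fineK f1) -(fineK f2) -(fineK fa) -!EFinD !lte_fin !lee_fin.
  have := metric_triangle (gamma t0) (gamma t') (gamma x).
  rewrite /e in dt' *; move: dt'; lra.
by rewrite leNgt t0t'.
Qed.

(** The length of an arc bounds the distance between its ends, so the arc-length parametrization is
    1-Lipschitz. *)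
Lemma mdist_arc_param a b (s s' : R) : rectifiable_curve a b gamma ->
  (0 <= s)%R -> (s <= s')%R -> s'%:E <= curve_length a b gamma ->
  (mdist (arc_param a b gamma s) (arc_param a b gamma s') <= s' - s)%R.
Proof.
move=> rg s0 ss' s'L; rewrite /arc_param.
have get l : (0 <= l)%R -> l%:E <= curve_length a b gamma ->
    let t := xget a [set t | (t \in `[a, b])%R /\ curve_length a t gamma = l%:E] in
    (t \in `[a, b])%R /\ curve_length a t gamma = l%:E.
  move=> l0 lL; case: xgetP => [t -> //|h].
  by have [t tab Lt] := curve_length_attained rg l0 lL; case: (h t).
have [] := get s s0 (le_trans (ss' : s%:E <= s'%:E) s'L).
have [] := get s' (le_trans s0 ss') s'L => /=.
set t := xget _ _; set t' := xget _ _.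
rewrite !in_itv/= => /andP[at1 tb] Lt /andP[at' t'b] Lt'.
have key u v (lu lv : R) : (a <= u)%R -> (u <= v)%R -> curve_length a u gamma = lu%:E ->
    curve_length a v gamma = lv%:E -> (mdist (gamma u) (gamma v) <= lv - lu)%R.
  move=> au uv Lu Lv; have := mdist_le_curve_length uv.
  move: Lv; rewrite (curve_lengthD au uv) Lu; case: curve_length => [r| |]//=.
  by rewrite -EFinD => -[<-]; rewrite lee_fin addrC addKr.
(* In the second case the chosen times come in reverse order, which forces [s = s'] and a zero
   distance. *)
have [tt'|t't] := leP t' t; first exact: key.
have := key _ _ _ _ at1 (ltW t't) Lt Lt'; rewrite metric_sym => h.
by move: h (mdist_ge0 (gamma t') (gamma t)); move: ss'; lra.
Qed.

Lemma arc_param0 a b : rectifiable_curve a b gamma -> arc_param a b gamma 0 = gamma a.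
Proof.
move=> rg; rewrite /arc_param; case: xgetP => [t _ [+ Lt]|//].
rewrite in_itv/= => /andP[at1 tb]; apply/esym/mdist_positivity/eqP.
by rewrite eq_le mdist_ge0 andbT -lee_fin -Lt mdist_le_curve_length.
Qed.

Lemma arc_param_length a b : rectifiable_curve a b gamma ->
  arc_param a b gamma (fine (curve_length a b gamma)) = gamma b.
Proof.
move=> rg; have [ab _ Loo] := rg.
have fL : curve_length a b gamma \is a fin_num.
  by rewrite ge0_fin_numE// curve_length_ge0// ltW.
rewrite /arc_param fineK//; case: xgetP => [t _ [+ Lt]|/(_ b)]; last first.
  by case; split => //; rewrite in_itv/= lexx ltW.
rewrite in_itv/= => /andP[at1 tb]; apply/mdist_positivity/eqP.
rewrite eq_le mdist_ge0 andbT -lee_fin; apply: le_trans (mdist_le_curve_length tb) _.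
move: Lt fL; rewrite (curve_lengthD at1 tb).
case: (curve_length a t gamma) => [r| |]//=; case: (curve_length t b gamma) => [r'| |]//=.
by rewrite -EFinD => -[] h _; rewrite lee_fin; move: h; lra.
Qed.

End curve_length.

Section upper_gradient_criterion.
Context (R : realType) (X : pointedMetricType R).

(** The arc-length interval is cut into equal pieces shorter than [d]. On each piece [g] dominates
    the difference quotient of [u] between the ends, so its integral dominates a telescoping sum. *)
Lemma upper_gradient_locally (u : X -> R) (g : X -> \bar R) (d : R) :
  0 < d -> measurable_fun [set: g_sigma_algebraType (@open X)] g ->
  (forall x, (0 <= g x)%E) ->
  (forall x y z, mdist x y < d -> mdist x z < d -> mdist y z < d ->
    (`|u y - u x|%:E <= (mdist x y)%:E * g z)%E) ->
  upper_gradient (EFin \o u) g.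
Proof.
move=> d0 mg g0 ug; split=> // a b gamma rg _; split; last by case.
move=> _ _; rewrite /line_integral /=.
have [ab _ Loo] := rg; have Lge0 := curve_length_ge0 gamma (ltW ab).
have fL : curve_length a b gamma \is a fin_num by rewrite ge0_fin_numE.
set L := fine (curve_length a b gamma).
rewrite -(arc_param_length rg) -(arc_param0 rg) -/L.
set eta := arc_param a b gamma.
have L0 : 0 <= L by rewrite fine_ge0.
move: (L0); rewrite le_eqVlt => /predU1P[L00|Lgt0].
  by rewrite -L00 subrr normr0 integral_ge0.
pose N := (Num.truncn (L / d)).+1.
pose h := L / N%:R.
have N0 : 0 < N%:R :> R by rewrite ltr0n.
have h0 : 0 < h by rewrite divr_gt0.
have hd : h < d by rewrite ltr_pdivrMr// mulrC -ltr_pdivrMr// truncnS_gt.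
pose s_ (i : nat) : R := i%:R * h.
have sN : s_ N = L by rewrite /s_ mulrC divfK// gt_eqF.
have s_le i j : (i <= j)%N -> s_ i <= s_ j.
  by move=> ij; rewrite ler_wpM2r ?(ltW h0)// ler_nat.
have sS i : s_ i.+1 = s_ i + h by rewrite /s_ -natr1 mulrDl mul1r.
pose c i : R := `|u (eta (s_ i.+1)) - u (eta (s_ i))| / h.
pose A i : set R := `[s_ i, s_ i.+1[%classic.
have eta_lip (x y : R) : 0 <= x -> x <= y -> y <= L -> mdist (eta x) (eta y) <= y - x.
  by move=> x0 xy yL; apply: mdist_arc_param => //; rewrite -(fineK fL) lee_fin.
have s0 : s_ 0%N = 0 by rewrite /s_ mul0r.
have iN i : i \in iota 0 N -> (i < N)%N by rewrite mem_iota.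
have muA i : i \in iota 0 N -> lebesgue_measure (A i `&` `[0, L]%classic) = h%:E.
  move=> /iN iN'; rewrite setIidl.
    rewrite lebesgue_measure_itv/= lte_fin sS ltrDl h0 -EFinD.
    by rewrite addrAC subrr add0r.
  move=> x; rewrite /A/= !in_itv/= => /andP[sx xs].
  rewrite (le_trans _ sx) -?s0 ?s_le//= ltW// (lt_le_trans xs)// -sN s_le//.
apply: (@le_trans _ _ (\sum_(i <- iota 0 N) (c i)%:E *
    lebesgue_measure (A i `&` `[0%R, L]%classic))%E).
  rewrite big_seq; under eq_bigr => i iN' do rewrite muA// -EFinM.
  rewrite -big_seq sumEFin lee_fin.
  under eq_bigr do rewrite divfK ?gt_eqF//.
  have -> : u (eta L) - u (eta 0) = u (eta (s_ N)) - u (eta (s_ 0%N)).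
    by rewrite sN s0.
  rewrite -[iota 0 N]/(index_iota 0 N).
  rewrite -(@telescope_sumr _ 0%N N (fun i => u (eta (s_ i))))//.
  exact: ler_norm_sum.
apply: sum_indic_le_integral => //.
- by move=> i; rewrite /A; exact: measurable_itv.
- by move=> i; rewrite /c divr_ge0// ltW.
move=> x /=; rewrite in_itv/= => /andP[x0 xL].
have AP i : c i * \1_(A i) x != 0 -> s_ i <= x < s_ i.+1.
  apply: contraNT => xA; rewrite indicE memNset ?mulr0// /A/= in_itv/=.
  exact/negP.
apply: sum_single_le => //; first exact: (iota_uniq 0 N).
  have lt_of i j : s_ i <= x < s_ i.+1 -> s_ j <= x < s_ j.+1 -> (i <= j)%N.
    move=> /andP[ix _] /andP[_ xj]; have := le_lt_trans ix xj.
    by rewrite ltr_pM2r// ltr_nat ltnS.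
  move=> i j _ _ /AP ix /AP jx; apply/eqP; rewrite eqn_leq.
  by rewrite (lt_of _ _ ix jx) (lt_of _ _ jx ix).
move=> i /iN iN'; have [->//|/AP /andP[sx xs]] := eqVneq (c i * \1_(A i) x) 0.
apply: (@le_trans _ _ (c i)%:E).
  by rewrite lee_fin ler_piMr ?divr_ge0 ?(ltW h0)// indicE lern1 leq_b1.
have si0 : 0 <= s_ i by rewrite -s0 s_le.
have siL : s_ i.+1 <= L by rewrite -sN s_le.
have d1 : mdist (eta (s_ i)) (eta (s_ i.+1)) <= h.
  by apply: le_trans (eta_lip _ _ _ _ _) _; rewrite ?s_le// sS; lra.
have d2 : mdist (eta (s_ i)) (eta x) < d.
  apply: le_lt_trans hd; apply: le_trans (eta_lip _ _ si0 sx xL) _.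
  by move: xs; rewrite sS; lra.
have d3 : mdist (eta (s_ i.+1)) (eta x) < d.
  rewrite metric_sym; apply: le_lt_trans hd.
  apply: le_trans (eta_lip _ _ x0 (ltW xs) siL) _.
  by move: sx; rewrite sS; lra.
rewrite /c EFinM lee_pdivrMr// muleC.
apply: le_trans (ug _ _ _ (le_lt_trans d1 hd) d2 d3) _.
by rewrite lee_wpmul2r// lee_fin.
Qed.

End upper_gradient_criterion.

(** * Vitali covering and outer regularity *)

(** The index set is the image of an injection of [S] into the naturals, so no member is
    repeated. *)
Lemma countable_enumeration (T : pointedType) (S : set T) : countable S ->
  exists (I : set nat) (c : nat -> T), [/\ forall i, I i -> S (c i),
    forall x, S x -> exists2 i, I i & c i = x & {in I &, injective c}].
Proof.
move=> /countable_injP[f injf]; pose c n := xget point [set x | S x /\ f x = n].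
have cf x : S x -> c (f x) = x.
  move=> Sx; rewrite /c; case: xgetP => [y _ [Sy fyx]|/(_ x)]; last by case.
  by apply: injf; rewrite ?inE.
exists (f @` S), c; split.
- by move=> _ [x Sx <-]; rewrite cf.
- by move=> x Sx; exists (f x); [exists x|rewrite cf].
- by move=> i j /set_mem[x Sx <-] /set_mem[y Sy <-]; rewrite !cf// => ->.
Qed.

(** For each [n] only finitely many of the disjoint sets have measure above [1 / (n + 1)], because
    their total is at most [mu V]. *)
Lemma countable_disjoint_positive d (T : measurableType d) (R : realType)
    (mu : {measure set T -> \bar R}) (I : Type) (D : set I) (B : I -> set T)
    (V : set T) :
  measurable V -> (mu V < +oo)%E -> (forall i, D i -> measurable (B i)) ->
  (forall i, D i -> B i `<=` V) -> (forall i, D i -> 0 < mu (B i))%E ->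
  trivIset D B -> countable D.
Proof.
move=> mV Voo mB BV B0 tB.
pose D_ n := [set i | D i /\ (n.+1%:R^-1%:E < mu (B i))%E].
have -> : D = \bigcup_n D_ n.
  apply/seteqP; split=> [i Di|i [n _ []]//].
  have fB : mu (B i) \is a fin_num.
    rewrite ge0_fin_numE//; apply: le_lt_trans Voo; apply: le_measure; rewrite ?inE//.
    - exact: mB.
    - exact: BV.
  have f0 : 0 < fine (mu (B i)) by rewrite fine_gt0// B0//= -ge0_fin_numE.
  exists (Num.truncn (fine (mu (B i)))^-1) => //; split => //.
  rewrite -(fineK fB) lte_fin -[ltRHS]invrK ltf_pV2 ?posrE ?invr_gt0//.
  exact: truncnS_gt.
apply: bigcup_countable => // n _; apply: finite_set_countable.
apply: contrapT => /infiniteP /card_leP[g].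
pose f (k : nat) : I := val (g (SigSub (mem_set (Logic.I : [set: nat] k)))).
have Df k : D_ n (f k) by exact: set_mem (valP _).
have tF : trivIset setT (B \o f).
  move=> i j _ _ /tB ij; have /= fij := ij (Df i).1 (Df j).1.
  by have /(congr1 val) := @inj _ _ _ g _ _ (in_setT _) (in_setT _) (val_inj fij).
have fV : mu V \is a fin_num by rewrite ge0_fin_numE.
pose N := (Num.truncn (fine (mu V) * n.+1%:R)).+1.
have : ((N%:R / n.+1%:R)%:E <= mu V)%E.
  apply: (@le_trans _ _ (mu (\bigcup_k (B \o f) k))); last first.
    apply: le_measure; rewrite ?inE//.
      by apply: bigcup_measurable => k _; apply: mB; exact: (Df k).1.
    by apply: bigcup_sub => k _; apply: BV; exact: (Df k).1.
  rewrite measure_bigcup//; last by move=> k _; apply: mB; exact: (Df k).1.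
  apply: (@le_trans _ _ (\sum_(0 <= k < N | k \in setT) mu ((B \o f) k))%E); last first.
    exact: nneseries_lim_ge.
  apply: (@le_trans _ _ (\sum_(0 <= k < N | k \in [set: nat]) n.+1%:R^-1%:E)%E).
    under eq_bigl do rewrite in_setT.
    by rewrite sumEFin lee_fin sumr_const_nat subn0 mulr_natl.
  by apply: lee_sum => k _; rewrite ltW// (Df k).2.
rewrite -(fineK fV) lee_fin ler_pdivrMr ?ltr0n// leNgt => /negP; apply.
exact: truncnS_gt.
Qed.

Section vitali.
Context (R : realType) (X : pointedMetricType R).
Variables (D : set X) (k : X -> nat) (rho : X -> R).
Hypothesis rho_k : forall x y, (k y <= k x)%N -> rho x <= rho y.

(** Zorn's lemma is applied to disjoint families such that every ball meeting the family meets a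
    member of no larger rank [k]. As ranks are natural numbers, a largest remaining ball exists and
    no factor is lost in comparing radii. *)
Lemma vitali_greedy : (forall x, 0 < rho x) -> exists S : set X,
  [/\ S `<=` D, trivIset S (fun x => ball x (rho x)) &
    forall x, D x -> exists2 y, S y &
      rho x <= rho y /\ ball x (rho x) `&` ball y (rho y) !=set0].
Proof.
move=> rho0; pose B x : set X := ball x (rho x).
pose P (S : set X) := [/\ S `<=` D, trivIset S B &
  forall x, D x -> (exists2 y, S y & B x `&` B y !=set0) ->
    exists2 y, S y & (k y <= k x)%N /\ B x `&` B y !=set0].
have [F FP totF|S [[SD tS hS] maxS]] := @Zorn_bigcup _ P.
  split.
  - by apply: bigcup_sub => S /FP[].
  - move=> x y [S FS Sx] [S' FS' S'y] xy.
    have [SS'|S'S] := totF _ _ FS FS'.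
      by have [_ t _] := FP _ FS'; apply: t => //; exact: SS'.
    by have [_ t _] := FP _ FS; apply: t => //; exact: S'S.
  - move=> x Dx [y [S FS Sy] xy]; have [_ _ h] := FP _ FS.
    have [z Sz kz] := h x Dx (ex_intro2 _ _ y Sy xy).
    by exists z => //; exists S.
(* If some ball missed the maximal family, one of least rank among those could be added to it. *)
have meets x : D x -> exists2 y, S y & B x `&` B y !=set0.
  move=> Dx; apply: contrapT => nx.
  pose Q n := `[< exists2 z, D z /\ ~ (exists2 y, S y & B z `&` B y !=set0) & k z = n >].
  have exQ : exists n, Q n by exists (k x); apply/asboolP; exists x.
  case: (ex_minnP exQ) => n /asboolP[z [Dz nz] kz] minn.
  apply: (maxS (S `|` [set z])).
    split; first by move=> y; left.
    move=> /(_ z (or_intror erefl)) Sz; apply: nz; exists z => //.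
    by rewrite setIid; exists z; exact: ballxx.
  split.
  - by move=> y [/SD//|->].
  - move=> y y' [Sy|->] [Sy'|->] // yy'; first exact: tS.
      by case: nz; exists y => //; rewrite setIC.
    by case: nz; exists y'.
  - move=> y Dy [y' [Sy'|->] yy'].
      have [w Sw kw] := hS y Dy (ex_intro2 _ _ y' Sy' yy').
      by exists w => //; left.
    have [[w Sw yw]|nS] := pselect (exists2 w, S w & B y `&` B w !=set0).
      have [w' Sw' kw'] := hS y Dy (ex_intro2 _ _ w Sw yw).
      by exists w' => //; left.
    exists z; first by right.
    split=> //; rewrite kz; apply: minn; apply/asboolP.
    by exists y.
exists S; split => // x Dx.
have [y Sy [kyx xy]] := hS x Dx (meets x Dx).
by exists y => //; split => //; exact: rho_k.
Qed.

End vitali.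

Section metric_balls.
Context (R : realType) (X : pointedMetricType R).
Implicit Types (x y z : X) (r s : R).

Lemma ballP x r y : ball x r y <-> mdist x y < r.
Proof. by rewrite ballEmdist. Qed.

Lemma ball_subset x y r s : mdist x y + r <= s -> ball y r `<=` ball x s.
Proof.
move=> h z /ballP yz; apply/ballP; have := metric_triangle x y z; move: h yz; lra.
Qed.

Lemma open_metric_ball x r : open (ball x r).
Proof.
rewrite openE => y /ballP xy; apply/nbhs_ballP; exists (r - mdist x y) => /=.
  by rewrite subr_gt0.
by apply: ball_subset; rewrite addrC subrK.
Qed.

End metric_balls.

Section metric_measure.
Context (R : realType) (X : pointedMetricType R).
Variable mu : {outer_measure set X -> \bar R}.
Hypothesis bmu : borel_regular mu.
Local Open Scope ereal_scope.
Implicit Types (x y z : X) (r s : R) (A B E U V W : set X).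

Lemma open_caratheodory A : open A -> mu.-cara.-measurable A.
Proof. by move=> oA; apply: bmu.1; exact: sub_gen_smallest. Qed.

Lemma ball_caratheodory x r : mu.-cara.-measurable (ball x r).
Proof. exact/open_caratheodory/open_metric_ball. Qed.

(** Continuity from above, available inside [W] because it has finite measure. *)
Lemma nonincreasing_measure_eps W (T : (set X)^nat) (e : R) : (0 < e)%R ->
  mu W < +oo -> mu.-cara.-measurable W ->
  (forall n, mu.-cara.-measurable (T n)) -> nonincreasing_seq T ->
  exists n, mu (T n `&` W) <= mu (\bigcap_n (T n) `&` W) + e%:E.
Proof.
move=> e0 Woo mW mT ndT.
have cvg : mu (T n `&` W) @[n --> \oo] --> mu (\bigcap_n (T n) `&` W).
  have -> : \bigcap_n (T n) `&` W = \bigcap_n (T n `&` W).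
    apply/seteqP; split=> [x [h Wx] n _|x h]; first by split => //; exact: h.
    by split; [move=> n _; case: (h n Logic.I)|case: (h 0%N Logic.I)].
  apply: (@nonincreasing_cvg_mu _ (caratheodory_type mu) _ (cara_measure mu)
     (fun n => T n `&` W)).
  - by apply: le_lt_trans Woo; apply: le_outer_measure; exact: subIsetr.
  - by move=> n; exact: measurableI.
  - by apply: bigcap_measurable => // n _; exact: measurableI.
  - move=> m n mn; have /subsetPset Tnm := ndT _ _ mn.
    by apply/subsetPset; exact: setSI.
have fin : mu (\bigcap_n (T n) `&` W) \is a fin_num.
  rewrite ge0_fin_numE ?outer_measure_ge0//; apply: le_lt_trans Woo.
  by apply: le_outer_measure; exact: subIsetr.
have : \forall n \near \oo, mu (T n `&` W) < mu (\bigcap_n (T n) `&` W) + e%:E.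
  have lt_e : mu (\bigcap_n (T n) `&` W) < mu (\bigcap_n (T n) `&` W) + e%:E.
    by rewrite lteDl.
  exact: cvg (open_ereal_lt' lt_e).
by move=> [n _ /(_ n (leqnn _))/= /ltW ?]; exists n.
Qed.

(* [V] approximates [S] from outside and the complement of [V'] from inside. *)
Let approximable W S := forall e : R, (0 < e)%R -> exists V V' : set X,
  [/\ open V, open V', S `<=` V, ~` S `<=` V' & mu (V `&` V' `&` W) <= e%:E].

(** The set [V' n] is the [1 / (n + 1)]-neighbourhood of the complement of [S]. Since [S] is open,
    the sets [S] intersected with [V' n] decrease to the empty set. *)
Let approximable_open W S : mu W < +oo -> mu.-cara.-measurable W ->
  open S -> approximable W S.
Proof.
move=> Woo mW oS e e0.
pose V' n : set X := \bigcup_(y in ~` S) ball y n.+1%:R^-1.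
have oV' n : open (V' n) by apply: bigcup_open => y _; exact: open_metric_ball.
have oT n : open (S `&` V' n) by exact: openI.
have ndV : nonincreasing_seq (fun n => S `&` V' n).
  move=> m n mn; apply/subsetPset; apply: setIS => x [y Sy yx]; exists y => //.
  move: yx; apply: le_ball; rewrite lef_pV2 ?posrE ?ltr0n// ler_nat ltnS//.
have [n hn] := nonincreasing_measure_eps e0 Woo mW
  (fun n => open_caratheodory (oT n)) ndV.
exists S, (V' n); split => //.
  by move=> y Sy; exists y => //; apply: ballxx; rewrite invr_gt0 ltr0n.
apply: le_trans hn _; rewrite (_ : \bigcap_n (S `&` V' n) = set0).
  by rewrite set0I outer_measure0 add0e.
rewrite -subset0 => x hx; have [Sx _] := hx 0%N Logic.I.
move: oS; rewrite openE => /(_ x Sx) /nbhs_ballP[r /= r0 rS].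
have [_ [y Sy yx]] := hx (Num.truncn r^-1) Logic.I.
apply: Sy; apply: rS; apply: ball_sym; move: yx; apply: le_ball.
rewrite -[leRHS]invrK lef_pV2 ?posrE ?invr_gt0 ?ltr0n//.
exact/ltW/truncnS_gt.
Qed.

(** The intersection of all [V' k] need not be open; a finite intersection is, and continuity from
    above makes its excess at most [e / 2]. The other half of [e] is spread over the sets [V n] as a
    geometric series. *)
Let approximable_bigcup W (S : (set X)^nat) :
  mu W < +oo -> mu.-cara.-measurable W ->
  (forall n, approximable W (S n)) -> approximable W (\bigcup_n S n).
Proof.
move=> Woo mW aS e e0.
pose e_ n := (e / 2 / (2 ^ n.+1)%:R)%R.
have e_0 n : (0 < e_ n)%R by rewrite !divr_gt0// ltr0n expn_gt0.
have /choice[V /choice[V' hV]] := fun n => aS n _ (e_0 n).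
pose T n := \bigcup_n V n `&` \bigcap_(k < n) V' k.
have oV : open (\bigcup_n V n) by apply: bigcup_open => n _; case: (hV n).
have oV' n : open (\bigcap_(k < n) V' k).
  by rewrite bigcap_mkord; elim/big_ind: _ => //;
    [exact: openT|exact: openI|move=> k _; case: (hV k)].
have oT n : open (T n) by exact: openI.
have ndT : nonincreasing_seq T.
  move=> m n mn; apply/subsetPset; apply: setIS => x h k /= km; apply: h => /=.
  exact: leq_trans mn.
have e20 : (0 < e / 2)%R by rewrite divr_gt0.
have [n hn] := nonincreasing_measure_eps e20 Woo mW
  (fun n => open_caratheodory (oT n)) ndT.
exists (\bigcup_n V n), (\bigcap_(k < n) V' k); split => //.
- by move=> x [k _ Sx]; exists k => //; have [_ _ + _ _] := hV k; exact.
- move=> x Sx k _; have [_ _ _ + _] := hV k; apply => Skx.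
  by apply: Sx; exists k.
apply: le_trans hn _; rewrite [in leRHS](splitr e) EFinD leeD2r//.
apply: (@le_trans _ _ (mu (\bigcup_n (V n `&` V' n `&` W)))).
  apply: le_outer_measure => x [h Wx].
  have [[k _ Vk] _] := h 0%N Logic.I.
  by exists k => //; split => //; split => //; have [_ /(_ k (ltnSn k))] := h k.+1 Logic.I.
apply: le_trans (outer_measure_sigma_subadditive mu _) _.
apply: (@le_trans _ _ (\sum_(0 <= n <oo) (e_ n)%:E)).
  by apply: lee_nneseries => // k _; case: (hV k).
by have := @epsilon_trick0 R (e / 2) xpredT (ltW e20); apply: le_trans.
Qed.

(** Approximable sets form a sigma-algebra containing the open sets, hence contain a Borel hull [B]
    of [A]; what [V] adds to [B] lies in [V']. *)
Lemma outer_regular_open W A (e : R) : mu W < +oo -> open W -> A `<=` W ->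
  (0 < e)%R -> exists V, [/\ open V, A `<=` V, V `<=` W & mu V <= mu A + e%:E].
Proof.
move=> Woo oW AW e0; have mW := open_caratheodory oW.
have [B [bB AB muB]] := bmu.2 A.
have aB : approximable W B.
  apply: (bB (approximable W)); split; last first.
    by move=> O oO; exact: approximable_open.
  split.
  - by apply: approximable_open => //; exact: open0.
  - move=> S aS f f0; have [V [V' [oV oV' SV SV' h]]] := aS f f0.
    by exists V', V; split; rewrite ?setTD ?setCK// [V' `&` V]setIC.
  - by move=> S aS; exact: approximable_bigcup.
have [V [V' [oV oV' BV BV' h]]] := aB e e0.
exists (V `&` W); split => //.
- exact: openI.
- by move=> x Ax; split; [exact/BV/AB|exact: AW].
apply: (@le_trans _ _ (mu (B `|` (V `&` V' `&` W)))).
  apply: le_outer_measure => x [Vx Wx]; have [Bx|Bx] := pselect (B x); first by left.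
  by right; split => //; split => //; exact: BV'.
by apply: le_trans (outer_measureU2 _ _ _) _; rewrite muB leeD2l.
Qed.

End metric_measure.

Section doubling_measure.
Context (R : realType) (X : pointedMetricType R).
Variable mu : {outer_measure set X -> \bar R}.
Hypothesis bmu : borel_regular mu.
Variable Cmu : R.
Hypothesis dmu : doubling mu Cmu.
Local Open Scope ereal_scope.
Implicit Types (x y z : X) (r s : R) (A B E U V W : set X).

Lemma doubling_ge1 : (1 <= Cmu)%R. Proof. by case: dmu. Qed.

Lemma doubling_ge0 : (0 <= Cmu)%R. Proof. exact: le_trans doubling_ge1. Qed.

Lemma ball_measure_gt0 x r : (0 < r)%R -> 0 < mu (ball x r).
Proof.
move=> r0; have r20 : (0 < r / 2)%R by rewrite divr_gt0.
by have [] := dmu.2 x (r / 2)%R r20; rewrite mulrC divfK.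
Qed.

Lemma ball_measure_fin x r : mu (ball x r) < +oo.
Proof.
have m0 : (0 < Num.max r 1)%R by rewrite lt_max ltr01 orbT.
apply: (@le_lt_trans _ _ (mu (ball x (Num.max r 1)%R))).
  by apply/le_outer_measure/le_ball; rewrite le_max lexx.
have [_ _] := dmu.2 x _ m0; apply: le_lt_trans.
by rewrite lee_pemull ?outer_measure_ge0// lee_fin doubling_ge1.
Qed.

Lemma ball_doubling n x r : (0 < r)%R ->
  mu (ball x (2 ^+ n * r)) <= (Cmu ^+ n)%:E * mu (ball x r).
Proof.
move=> r0; elim: n => [|n ih]; first by rewrite !expr0 mul1r mul1e.
have rn : (0 < 2 ^+ n * r)%R by rewrite mulr_gt0// exprn_gt0.
rewrite exprS -mulrA; have [_ + _] := dmu.2 x _ rn; move=> /le_trans; apply.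
by rewrite exprS EFinM -muleA lee_wpmul2l// lee_fin doubling_ge0.
Qed.

Lemma subball_doubling n x y r s : (0 < r)%R -> (mdist x y + s <= 2 ^+ n * r)%R ->
  mu (ball y s) <= (Cmu ^+ n)%:E * mu (ball x r).
Proof.
move=> r0 h; apply: le_trans (ball_doubling n x r0).
exact/le_outer_measure/ball_subset.
Qed.

(** Balls inside a fixed ball have finite total measure when disjoint, so the greedy family is
    countable. Each ball meets a member at least as large, whence the factor 3. *)
Lemma vitali_covering (D : set X) (k : X -> nat) (rho : X -> R) x1 r1 :
  (forall x y, (k y <= k x)%N -> rho x <= rho y)%R -> (forall x, 0 < rho x)%R ->
  (forall x, D x -> ball x (rho x) `<=` ball x1 r1) ->
  exists (I : set nat) (c : nat -> X), [/\ forall i, I i -> D (c i),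
    trivIset I (fun i => ball (c i) (rho (c i))) &
    forall x, D x -> exists2 i, I i &
      ball x (rho x) `<=` ball (c i) (3 * rho (c i))].
Proof.
move=> rho_k rho0 DV; have [S [SD tS hS]] := vitali_greedy D rho_k rho0.
have cS : countable S.
  apply: (@countable_disjoint_positive _ (caratheodory_type mu) R (cara_measure mu)
    _ S (fun x => ball x (rho x)) (ball x1 r1)) => //.
  - exact: ball_caratheodory.
  - exact: ball_measure_fin.
  - by move=> x _; exact: ball_caratheodory.
  - by move=> x /SD; exact: DV.
  - by move=> x _; exact: ball_measure_gt0.
have [I [c [IS SI cinj]]] := countable_enumeration cS.
exists I, c; split.
- by move=> i /IS /SD.
- move=> i j Ii Ij h; apply: cinj; rewrite ?inE//; apply: tS => //; exact: IS.
- move=> x Dx; have [y Sy [xy [z [/ballP xz /ballP yz]]]] := hS x Dx.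
  have [i Ii ciy] := SI y Sy; exists i => //; rewrite ciy; apply: ball_subset.
  have := metric_triangle y z x; rewrite (metric_sym z x).
  by move: xy xz yz; lra.
Qed.

(** A local estimate becomes a global one: the tripled balls of the Vitali family cover [A], and the
    pieces of [F] in the original balls are disjoint, so the local bounds add up. *)
Lemma vitali_measure (D : set X) (k : X -> nat) (rho : X -> R) x1 r1
    (A F : set X) (a : R) :
  (forall x y, (k y <= k x)%N -> rho x <= rho y)%R -> (forall x, 0 < rho x)%R ->
  (forall x, D x -> ball x (rho x) `<=` ball x1 r1) ->
  mu.-cara.-measurable F -> (0 <= a)%R ->
  A `<=` \bigcup_(x in D) ball x (rho x) ->
  (forall x, D x -> mu (A `&` ball x (3 * rho x)) <=
                    a%:E * mu (F `&` ball x (rho x))) ->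
  mu A <= a%:E * mu (F `&` \bigcup_(x in D) ball x (rho x)).
Proof.
move=> rho_k rho0 DV mF a0 AD hA.
have [I [c [ID tI cov]]] := vitali_covering rho_k rho0 DV.
pose A_ n := if n \in I then A `&` ball (c n) (3 * rho (c n)) else set0.
pose F_ n := if n \in I then F `&` ball (c n) (rho (c n)) else set0.
apply: (@le_trans _ _ (mu (\bigcup_n A_ n))).
  apply: le_outer_measure => x Ax; have [y Dy yx] := AD x Ax.
  have [i Ii yi] := cov y Dy; exists i => //.
  by rewrite /A_ mem_set//; split => //; exact: yi.
apply: le_trans (outer_measure_sigma_subadditive mu _) _.
apply: (@le_trans _ _ (\sum_(0 <= n <oo) a%:E * mu (F_ n))).
  apply: lee_nneseries => // n _; rewrite /A_ /F_; case: ifPn => [/set_mem In|_].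
    exact/hA/ID.
  by rewrite !outer_measure0 mule0.
rewrite nneseriesZl//.
rewrite lee_wpmul2l//.
have mF_ n : mu.-cara.-measurable (F_ n).
  rewrite /F_; case: ifPn => _; last exact: measurable0.
  apply: measurableI => //; exact: ball_caratheodory.
have tF : trivIset setT F_.
  move=> i j _ _ [x []]; rewrite /F_.
  case: ifPn => [/set_mem Ii [_ ix]|//]; case: ifPn => [/set_mem Ij [_ jx]|//].
  by apply: tI => //; exists x.
have := @measure_bigcup _ _ (caratheodory_type mu) (cara_measure mu) setT F_
  (fun n _ => mF_ n) tF.
rewrite /=; under eq_eseriesl do rewrite in_setT.
move=> <-; apply: le_outer_measure => x [n _]; rewrite /F_.
by case: ifPn => [/set_mem In [Fx cx]|//]; split => //; exists (c n) => //; exact: ID.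
Qed.

(** A substitute for the Lebesgue density theorem. Cover the exceptional set [N] by small balls
    inside an open [V] with [mu V <= mu N + e]; low density in each gives [mu N <= (mu N + e) / 2],
    hence [mu N <= e]. *)
Lemma weak_density E x0 r0 (gam : R) : (0 < r0)%R -> E `<=` ball x0 r0 ->
  (0 <= gam)%R -> (gam * Cmu ^+ 2 <= 2^-1)%R ->
  mu [set x | E x /\ forall k, mu (E `&` ball x (2 ^- k * r0)) <=
                               gam%:E * mu (ball x (2 ^- k * r0))] = 0.
Proof.
move=> r00 EB gam0 gamC; set N := [set x | _].
have NE : N `<=` E by move=> x [].
have NB : N `<=` ball x0 r0 by exact: subset_trans EB.
have fN : mu N \is a fin_num.
  rewrite ge0_fin_numE ?outer_measure_ge0//.
  by apply: le_lt_trans (ball_measure_fin x0 r0); exact: le_outer_measure.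
apply/eqP; rewrite eq_le outer_measure_ge0 andbT.
apply/lee_addgt0Pr => e e0; rewrite add0e.
have [V [oV NV VB muV]] := outer_regular_open bmu (ball_measure_fin x0 r0)
  (open_metric_ball x0 r0) NB e0.
have exk x : exists k, N x -> ball x (2 ^- k * r0) `<=` V.
  have [Nx|] := pselect (N x); last by exists 0%N.
  move: oV; rewrite openE => /(_ x (NV _ Nx)) /nbhs_ballP[r /= rgt0 rV].
  exists (Num.truncn (r0 / r)) => _; apply: subset_trans rV; apply: le_ball.
  rewrite ler_pdivrMl ?exprn_gt0// -ler_pdivrMr//.
  apply: le_trans (ltW (truncnS_gt _)) _; rewrite -natrX ler_nat.
  exact: ltn_expl.
have [k hk] := choice exk.
(* A quarter of the dyadic radius: the tripled ball still lies in the dyadic ball where [E] is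
   sparse, and two doublings lead back. *)
pose rho x := (2 ^- (k x + 2) * r0)%R.
have rho4 x : (4 * rho x = 2 ^- k x * r0)%R.
  rewrite /rho exprD invfM; field.
  by rewrite expf_neq0.
have rho0 x : (0 < rho x)%R by rewrite mulr_gt0// invr_gt0 exprn_gt0.
have rhoV x : N x -> ball x (rho x) `<=` V.
  move=> Nx; apply: subset_trans (hk x Nx); apply: le_ball.
  by rewrite -rho4; move: (rho0 x); lra.
have : mu N <= (gam * Cmu ^+ 2)%:E * mu (V `&` \bigcup_(x in N) ball x (rho x)).
  apply: (@vitali_measure N k rho x0 r0).
  - move=> x y kyx; rewrite ler_wpM2r ?(ltW r00)// lef_pV2 ?posrE ?exprn_gt0//.
    by rewrite ler_weXn2l ?leq_add2r// ler1n.
  - by [].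
  - by move=> x Nx; exact: subset_trans (rhoV x Nx) VB.
  - exact: open_caratheodory.
  - by rewrite mulr_ge0// exprn_ge0// doubling_ge0.
  - by move=> x Nx; exists x => //; exact: ballxx.
  - move=> x Nx; rewrite [V `&` _]setIC (setIidl (rhoV x Nx)).
    apply: (@le_trans _ _ (mu (E `&` ball x (2 ^- k x * r0)))).
      apply: le_outer_measure; apply: setISS => //; apply: le_ball.
      by rewrite -rho4; move: (rho0 x); lra.
    apply: le_trans (Nx.2 (k x)) _; rewrite EFinM -muleA lee_wpmul2l//.
    rewrite -rho4 (_ : 4 = 2 ^+ 2)%R; last by rewrite expr2; lra.
    exact: ball_doubling.
move=> h; have {}h : mu N <= 2^-1%:E * (mu N + e%:E).
  apply: le_trans h _.
  apply: (@le_trans _ _ (2^-1%:E * mu (V `&` \bigcup_(x in N) ball x (rho x)))).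
    by rewrite lee_wpmul2r ?outer_measure_ge0// lee_fin.
  rewrite lee_wpmul2l//; apply: le_trans muV; apply: le_outer_measure.
  exact: subIsetl.
move: h; rewrite -(fineK fN) -EFinD -EFinM !lee_fin; lra.
Qed.

End doubling_measure.

(** * Boundary layers and the Poincare inequality *)

(** The function is the supremum of 0 and of the cones [1 - mdist x y / t] with vertex [y] in [G];
    including 0 covers empty [G] as well. *)
Lemma lipschitz_cutoff (R : realType) (X : pointedMetricType R) (G : set X) (t : R) :
  0 < t -> exists w : X -> R, [/\ forall x, 0 <= w x <= 1,
    forall x, G x -> w x = 1, forall x, 0 < w x -> exists2 y, G y & mdist x y < t &
    forall x y, `|w x - w y| <= mdist x y / t].
Proof.
move=> t0; pose S x := [set 0] `|` [set 1 - mdist x y / t | y in G].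
pose w x := sup (S x).
have S0 x : S x 0 by left.
have Sub x : ubound (S x) 1.
  by move=> _ [->//|[y _ <-]]; rewrite gerBl divr_ge0 ?mdist_ge0// ltW.
have supS x : has_sup (S x) by split; [exists 0|exists 1].
have wS x e : S x e -> e <= w x by move=> Se; exact: sup_ubound (supS x).2 _ Se.
have wle x e : ubound (S x) e -> w x <= e by apply: sup_le_ub; exists 0.
have w01 x : 0 <= w x <= 1 by rewrite wS// wle.
exists w; split => //.
- move=> x Gx; apply/eqP; rewrite eq_le; have /andP[_ ->]/= := w01 x.
  by apply: wS; right; exists x => //; rewrite mdistxx mul0r subr0.
- move=> x wx0; apply: contrapT => nG; move: wx0; rewrite ltNge => /negP; apply.
  apply: wle => _ [->//|[y Gy <-]]; rewrite subr_le0 ler_pdivlMr// mul1r leNgt.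
  by apply/negP => xy; apply: nG; exists y.
have wlip x y : w x <= w y + mdist x y / t.
  apply: wle => _ [->|[z Gz <-]].
    by rewrite addr_ge0 ?wS// divr_ge0 ?mdist_ge0// ltW.
  have : 1 - mdist y z / t <= w y by apply: wS; right; exists z.
  have := metric_triangle y x z; rewrite (metric_sym y x).
  rewrite -(ler_pM2r (_ : 0 < t^-1)) ?invr_gt0// mulrDl; lra.
move=> x y; rewrite ler_norml; have := wlip x y; have := wlip y x.
rewrite (metric_sym y x); lra.
Qed.

Section poincare_scale.
Context (R : realType) (X : pointedMetricType R).
Variable mu : {outer_measure set X -> \bar R}.
Hypothesis bmu : borel_regular mu.
Variable Cmu : R.
Hypothesis dmu : doubling mu Cmu.
Local Open Scope ereal_scope.
Implicit Types (x y z : X) (r s : R) (A B U V W : set X).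

Lemma subball_measure_fin A x r : A `<=` ball x r -> mu A \is a fin_num.
Proof.
move=> AB; rewrite ge0_fin_numE ?outer_measure_ge0//.
by apply: le_lt_trans (ball_measure_fin dmu x r); exact: le_outer_measure.
Qed.

Lemma lipschitz_open_gt (w : X -> R) (K a : R) : (0 < K)%R ->
  (forall x y, `|w x - w y| <= mdist x y / K)%R -> open [set x | a < w x]%R.
Proof.
move=> K0 wlip; rewrite openE => x /= awx; apply/nbhs_ballP.
exists (K * (w x - a))%R => /=; first by rewrite mulr_gt0// subr_gt0.
move=> y /ballP xy /=; have := wlip x y; rewrite ler_norml => /andP[_].
have : (mdist x y / K < w x - a)%R by rewrite ltr_pdivrMr// mulrC.
lra.
Qed.

Lemma lipschitz_open_lt (w : X -> R) (K a : R) : (0 < K)%R ->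
  (forall x y, `|w x - w y| <= mdist x y / K)%R -> open [set x | w x < a]%R.
Proof.
move=> K0 wlip; have := @lipschitz_open_gt (fun x => - w x)%R K (- a)%R K0.
under eq_set do rewrite ltrN2.
by apply=> x y; rewrite -opprD normrN.
Qed.

Lemma lipschitz_measurable (D : set X) (w : X -> R) (K : R) : (0 < K)%R ->
  mu.-cara.-measurable D ->
  (forall x y, `|w x - w y| <= mdist x y / K)%R ->
  measurable_fun (D : set (caratheodory_type mu)) w.
Proof.
move=> K0 mD wlip.
apply: (measurability _ (RGenOInfty.measurableE R)) => //= _ [_ [a ->] <-].
apply: measurableI => //; apply: open_caratheodory => //.
rewrite (_ : _ @^-1` _ = [set x | a < w x]%R); first exact: lipschitz_open_gt K0 wlip.
by apply/seteqP; split => x /=; rewrite in_itv/= andbT.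
Qed.

Lemma lipschitz_locally_integrable (w : X -> R) (K : R) : (0 < K)%R ->
  (forall x y, `|w x - w y| <= mdist x y / K)%R -> (forall x, 0 <= w x <= 1)%R ->
  locally_integrable_mu mu (EFin \o w).
Proof.
move=> K0 wlip w01 x; exists 1%R => //; apply/integrableP; split.
  apply/measurable_EFinP; apply: lipschitz_measurable K0 _ wlip.
  exact: ball_caratheodory.
apply: (@le_lt_trans _ _ (\int[cara_measure mu]_(y in ball x 1%R) (cst 1 y))).
  apply: le_integral_nonmeasurable => // y _ /=; rewrite lee_fin.
  by have /andP[w0 w1] := w01 y; rewrite ger0_norm.
rewrite integral_cst//; last exact: ball_caratheodory.
by rewrite mul1e; exact: (ball_measure_fin dmu).
Qed.

End poincare_scale.

Section boundary_layer.
Context (R : realType) (X : pointedMetricType R).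
Variable mu : {outer_measure set X -> \bar R}.
Hypothesis bmu : borel_regular mu.
Variable Cmu : R.
Hypothesis dmu : doubling mu Cmu.
Local Open Scope ereal_scope.
Implicit Types (x y z : X) (r s : R) (A B U V W : set X).

(** The radius [4 * t] is such that the ball contains the tripled ball [ball z (3 * t)] of a Vitali
    covering whenever [z] is within [t] of its centre. *)
Definition dense_points (E : set X) (c t : R) : set X :=
  [set y | mu (ball y (4 * t) `\` E) < c%:E * mu (ball y (4 * t))].

(** The points of [E] from which a definite portion of the complement is visible at scale [t]. The
    radius [5 * t] is the [3 * t] of [transition] plus the radius [2 * t] of the balls placed
    there. *)
Definition boundary_layer (E : set X) (c t : R) : set X :=
  E `&` \bigcup_(x in ~` dense_points E c t) ball x (5 * t).

Variable E : set X.
Hypothesis mE : mu.-cara.-measurable E.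

Lemma measurable_boundary_layer c t :
  mu.-cara.-measurable (boundary_layer E c t).
Proof.
apply: measurableI => //; apply: open_caratheodory => //.
by apply: bigcup_open => x _; exact: open_metric_ball.
Qed.

Let transition (G : set X) t : set X := [set y | G y /\
  exists2 x, ~ G x & (mdist y x < 3 * t)%R].

(* A Lipschitz function which is 1 on [G] and vanishes off the [t]-neighbourhood
   of [G] only varies near [transition G t]. *)
Let cutoff_upper_gradient (G : set X) (w : X -> R) t : (0 < t)%R ->
  (forall x, 0 <= w x <= 1)%R -> (forall x, G x -> w x = 1%R) ->
  (forall x, (0 < w x)%R -> exists2 y, G y & (mdist x y < t)%R) ->
  (forall x y, `|w x - w y| <= mdist x y / t)%R ->
  upper_gradient (EFin \o w) (fun x =>
    (t^-1 * \1_(\bigcup_(y in transition G t) ball y (2 * t)) x)%:E).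
Proof.
move=> t0 w01 w1 w0 wlip; set O := \bigcup_(y in _) _.
have oO : open O by apply: bigcup_open => y _; exact: open_metric_ball.
apply: (upper_gradient_locally t0).
- apply/measurable_EFinP; apply: measurable_funM => //.
  by apply: measurable_indic; exact: sub_gen_smallest.
- by move=> x; rewrite lee_fin mulr_ge0// invr_ge0 ltW.
move=> x y z xy xz yz; rewrite -EFinM lee_fin.
have [wxy|wxy] := eqVneq (w y) (w x).
  by rewrite wxy subrr normr0 !mulr_ge0 ?mdist_ge0// invr_ge0 ltW.
(* If [w] differs at [x] and [y], one of them is within [t] of [G] and one lies off [G]; hence [z]
   is within [2 * t] of [G] and within [t] of its complement. *)
suff Oz : O z by rewrite indicE mem_set// mulr1 distrC wlip.
have [y' Gy' zy'] : exists2 y', G y' & (mdist z y' < 2 * t)%R.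
  have near u : (mdist u z < t)%R -> (0 < w u)%R ->
      exists2 y', G y' & (mdist z y' < 2 * t)%R.
    move=> uz /w0[y' Gy' uy']; exists y' => //.
    by have := metric_triangle z u y'; rewrite (metric_sym z u); lra.
  have [wx|wx] := ltP 0%R (w x); first exact: near wx.
  have [wy|wy] := ltP 0%R (w y); first exact: near wy.
  have := w01 x; have := w01 y; move: wxy; rewrite neq_lt; lra.
have [x' Gx' zx'] : exists2 x', ~ G x' & (mdist z x' < t)%R.
  have [/w1 wx|Gx] := pselect (G x); last by exists x => //; rewrite metric_sym.
  have [/w1 wy|Gy] := pselect (G y); last by exists y => //; rewrite metric_sym.
  by rewrite wx wy eqxx in wxy.
exists y'; last by apply/ballP; rewrite metric_sym.
split => //; exists x' => //.
by have := metric_triangle y' z x'; rewrite (metric_sym y' z); lra.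
Qed.

(** By the choice of [c], [E] fills at least half of [ball y (2 * t)] around a dense point [y]. A
    Vitali covering thus replaces the balls by their parts in [E], which lie in the layer. *)
Let measure_transition (c t : R) x s : (0 < t)%R ->
    (0 <= c)%R -> (c * Cmu <= 2^-1)%R ->
  mu (\bigcup_(y in transition (dense_points E c t) t) ball y (2 * t) `&` ball x s)
  <= (2 * Cmu ^+ 2)%:E * mu (boundary_layer E c t `&` ball x (s + 4 * t)).
Proof.
move=> t0 c0 cC; set G := dense_points E c t.
pose D := [set y | transition G t y /\ ball y (2 * t) `&` ball x s !=set0].
have t20 : (0 < 2 * t)%R by rewrite mulr_gt0.
have DB y : D y -> ball y (2 * t) `<=` ball x (s + 4 * t).
  move=> [_ [z [/ballP yz /ballP xz]]]; apply: ball_subset.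
  by have := metric_triangle x z y; rewrite (metric_sym z y); lra.
have C0 := doubling_ge0 dmu.
apply: (@le_trans _ _ ((2 * Cmu ^+ 2)%:E * mu (E `&` \bigcup_(y in D) ball y (2 * t)))).
  apply: (@vitali_measure _ _ _ bmu _ dmu D (fun=> 0%N) (fun=> 2 * t)%R x (s + 4 * t)%R).
  - by [].
  - by [].
  - exact: DB.
  - exact: mE.
  - by rewrite mulr_ge0// exprn_ge0.
  - by move=> z [[y Gy yz] xz]; exists y => //; split => //; exists z.
  move=> y [[Gy _] _].
  apply: (@le_trans _ _ (mu (ball y (2 ^+ 2 * (2 * t))))).
    apply: le_outer_measure; apply: subset_trans (@subIsetr _ _ _) _; apply: le_ball.
    by rewrite expr2; lra.
  apply: le_trans (ball_doubling dmu 2 y t20) _.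
  rewrite [X in _ <= X * _](_ : _ = (Cmu ^+ 2)%:E * 2%:E); last by rewrite -EFinM mulrC.
  rewrite -muleA lee_wpmul2l ?lee_fin ?exprn_ge0//.
  have fb : mu (ball y (2 * t)) \is a fin_num.
    exact: (subball_measure_fin dmu (@subset_refl _ _)).
  have fe : mu (E `&` ball y (2 * t)) \is a fin_num.
    exact: (subball_measure_fin dmu (@subIsetr _ _ _)).
  have fd : mu (ball y (4 * t) `\` E) \is a fin_num.
    exact: (subball_measure_fin dmu (@subDsetl _ _ _)).
  have f4 : mu (ball y (4 * t)) \is a fin_num.
    exact: (subball_measure_fin dmu (@subset_refl _ _)).
  have := ball_doubling dmu 1 y t20.
  rewrite expr1 (_ : 2 * (2 * t) = 4 * t)%R; last by lra.
  have : mu (ball y (2 * t)) <= mu (E `&` ball y (2 * t)) + mu (ball y (4 * t) `\` E).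
    apply: le_trans (outer_measureU2 _ _ _); apply: le_outer_measure => z yz.
    have [Ez|Ez] := pselect (E z); [by left|right; split => //].
    by move: yz; apply: le_ball; lra.
  move: (Gy : mu _ < _).
  rewrite expr1 -(fineK fb) -(fineK fe) -(fineK fd) -(fineK f4).
  rewrite -!EFinM -EFinD !lee_fin lte_fin.
  set b := fine (mu (ball y (2 * t))); set q := fine (mu (ball y (4 * t))).
  have b0 : (0 <= b)%R by rewrite fine_ge0.
  move=> dq be qb.
  have cqb : (c * q <= c * (Cmu * b))%R by rewrite ler_wpM2l.
  have cb : (c * Cmu * b <= 2^-1 * b)%R by rewrite ler_wpM2r.
  by move: cqb cb dq be; rewrite mulrA; lra.
rewrite lee_wpmul2l// ?lee_fin ?mulr_ge0 ?exprn_ge0//.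
apply: le_outer_measure => z [Ez [y [[Gy [x' Gx' yx']] Dy] yz]].
split; last by apply: (DB y) yz; split => //; split => //; exists x'.
split => //; exists x' => //; apply/ballP; move/ballP: yz => yz.
by have := metric_triangle x' y z; rewrite (metric_sym x' y); lra.
Qed.

(** Whichever side of 1/2 the value [a] lies on, finite or not, it is at distance at least 1/2 from
    the value of [w] on [A0] or on [A1]. *)
Let oscillation_ge (B A0 A1 : set X) (w : X -> R) (a : \bar R) (e : R) :
  mu.-cara.-measurable B -> mu.-cara.-measurable A0 -> mu.-cara.-measurable A1 ->
  A0 `<=` B -> A1 `<=` B -> (forall x, A0 x -> w x = 0%R) ->
  (forall x, A1 x -> w x = 1%R) -> e%:E <= mu A0 -> e%:E <= mu A1 ->
  (e / 2)%:E <= \int[cara_measure mu]_(x in B) `|(w x)%:E - a|.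
Proof.
move=> mB m0 m1 A0B A1B w0 w1 e0 e1.
have [a2|a2] := leP a (2^-1)%:E.
  apply: (@le_trans _ _ (2^-1%:E * mu A1)).
    by rewrite mulrC EFinM lee_wpmul2l// lee_fin.
  apply: (@cst_indic_le_integral _ (caratheodory_type mu) _ (cara_measure mu)) => //.
  move=> x /w1 ->; case: a a2 => [r| |]//=.
  by rewrite !lee_fin => r2; rewrite ger0_norm; lra.
apply: (@le_trans _ _ (2^-1%:E * mu A0)).
  by rewrite mulrC EFinM lee_wpmul2l// lee_fin.
apply: (@cst_indic_le_integral _ (caratheodory_type mu) _ (cara_measure mu)) => //.
move=> x /w0 ->; case: a a2 => [r| |]//=.
by rewrite !lee_fin lte_fin => r2; rewrite ler0_norm; lra.
Qed.

(** Around a point within [t] of a dense point, the complement of [E] is sparse in the tripled ball;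
    a Vitali covering adds this up. So the cutoff is positive on only a small part of the
    complement. *)
Let measure_near_dense (c t : R) x r : (0 < t)%R -> (t <= r)%R -> (0 <= c)%R ->
  mu ((ball x r `\` E) `&`
      [set z | exists2 y, dense_points E c t y & (mdist z y < t)%R])
  <= (c * Cmu ^+ 4)%:E * mu (ball x r).
Proof.
move=> t0 tr c0; set F := _ `&` _.
have r0 : (0 < r)%R by exact: lt_le_trans tr.
have C0 := doubling_ge0 dmu.
have FB z : F z -> ball z t `<=` ball x (2 * r).
  by move=> [[/ballP xz _] _]; apply: ball_subset; lra.
apply: (@le_trans _ _ ((c * Cmu ^+ 3)%:E * mu (setT `&` \bigcup_(z in F) ball z t))).
  apply: (@vitali_measure _ _ _ bmu _ dmu F (fun=> 0%N) (fun=> t)%R x (2 * r)%R) => //.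
  - by rewrite mulr_ge0// exprn_ge0.
  - by move=> z Fz; exists z => //; exact: ballxx.
  move=> z [_ [y Gy zy]].
  apply: (@le_trans _ _ (mu (ball y (4 * t) `\` E))).
    apply: le_outer_measure => u [[[_ Eu] _] zu]; split => //; move: zu.
    by apply: ball_subset; rewrite metric_sym; lra.
  apply: le_trans (ltW Gy) _; rewrite EFinM -muleA lee_wpmul2l// setTI.
  by apply: subball_doubling => //; rewrite !exprS expr0; lra.
rewrite setTI (_ : (c * Cmu ^+ 4)%:E = (c * Cmu ^+ 3)%:E * Cmu%:E); last first.
  by rewrite -EFinM -mulrA -exprSr.
rewrite -muleA.
rewrite lee_wpmul2l ?lee_fin ?mulr_ge0 ?exprn_ge0//.
have := ball_doubling dmu 1 x r0; rewrite !expr1; apply: le_trans.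
by apply: le_outer_measure; apply: bigcup_sub => z; exact: FB.
Qed.

(** Either the cutoff [w] is below 1 on much of [E], and those points are in the layer; or [w] is 1
    on much of [E] and 0 on much of the complement, and the Poincare inequality forces its gradient,
    hence the layer, to be large. The value of [c] makes [c * Cmu ^+ 4] half of [c1]. *)
Lemma boundary_layer_measure (CP tauP c1 c t : R) x r :
  poincare11 mu CP tauP -> (0 < t)%R -> (t <= r)%R -> (0 < c1)%R ->
  c1%:E * mu (ball x r) <= mu (E `&` ball x r) ->
  c1%:E * mu (ball x r) <= mu (ball x r `\` E) ->
  c = (c1 / (2 * Cmu ^+ 4))%R ->
  (c1 / (8 * CP * Cmu ^+ 2) * (t / r))%:E * mu (ball x r) <=
  mu (boundary_layer E c t `&` ball x (tauP * r + 4 * t)).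
Proof.
move=> [CP1 tauP1 poinc] t0 tr c10 dE dCE cE.
have r0 : (0 < r)%R by exact: lt_le_trans tr.
have C1 := doubling_ge1 dmu; have C0 := doubling_ge0 dmu.
have Cn n : (1 <= Cmu ^+ n)%R by exact: exprn_ege1.
set B := ball x r; set T := ball x (tauP * r).
have BT : B `<=` T by apply: le_ball; rewrite ler_peMl// ltW.
have mB : mu.-cara.-measurable B by exact: ball_caratheodory.
have mT : mu.-cara.-measurable T by exact: ball_caratheodory.
have fin A : A `<=` T -> mu A \is a fin_num by exact: (subball_measure_fin dmu).
have fB := fin _ BT; have fT := fin _ (@subset_refl _ T).
pose b := fine (mu B); pose m := fine (mu T).
have b0 : (0 < b)%R by rewrite fine_gt0// (ball_measure_gt0 dmu)//= -ge0_fin_numE.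
have bm : (b <= m)%R by rewrite fine_le//; exact: le_outer_measure.
have m0 : (0 < m)%R by exact: lt_le_trans bm.
have BE : mu B = b%:E by rewrite fineK.
have TE : mu T = m%:E by rewrite fineK.
have c11 : (c1 <= 1)%R.
  have : c1%:E * mu B <= mu B.
    by apply: le_trans dE _; apply: le_outer_measure; exact: subIsetr.
  by rewrite BE -EFinM lee_fin ger_pMl.
have c0 : (0 < c)%R by rewrite cE divr_gt0// mulr_gt0// exprn_gt0// (lt_le_trans ltr01).
have cC4 : (c * Cmu ^+ 4 = c1 / 2)%R.
  by rewrite cE; field; rewrite gt_eqF// (lt_le_trans ltr01).
have cC : (c * Cmu <= 2^-1)%R.
  apply: (@le_trans _ _ (c * Cmu ^+ 4)%R).
    by rewrite ler_pM2l// -[leLHS]expr1 ler_weXn2l.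
  by rewrite cC4; lra.
set L := boundary_layer E c t; set c2 := (c1 / _)%R.
have [w [w01 w1 w0 wlip]] := lipschitz_cutoff (dense_points E c t) t0.
have olt a := lipschitz_open_lt a t0 wlip; have ogt a := lipschitz_open_gt a t0 wlip.
pose F1 := E `&` B `&` [set z | w z < 1]%R.
pose A1 := (E `&` B) `\` [set z | w z < 1]%R.
pose A0 := (B `\` E) `\` [set z | 0 < w z]%R.
have mA0 : mu.-cara.-measurable A0.
  by apply: measurableD; [exact: measurableD|exact: open_caratheodory].
have mA1 : mu.-cara.-measurable A1.
  by apply: measurableD; [exact: measurableI|exact: open_caratheodory].
have A0B : A0 `<=` B by move=> z [[]].
have A1B : A1 `<=` B by move=> z [[]].
have F1B : F1 `<=` B by move=> z [[]].
have hA0 : (c1 / 2 * b)%:E <= mu A0.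
  have := measure_near_dense x t0 tr (ltW c0); rewrite cC4.
  set F0 := _ `&` _ => hF0.
  have : mu (B `\` E) <= mu A0 + mu F0.
    apply: le_trans (outer_measureU2 _ _ _); apply: le_outer_measure => z Bz.
    have [wz|wz] := pselect (0 < w z)%R; last by left.
    by right; split => //; exact: w0.
  have fF0 : mu F0 \is a fin_num by apply: fin => z [[/BT]].
  have fA0 : mu A0 \is a fin_num by apply: fin => z /A0B /BT.
  move=> /(le_trans dCE); move: hF0; rewrite -/B BE -(fineK fF0) -(fineK fA0).
  by rewrite -!EFinM -EFinD !lee_fin; lra.
have fF1 : mu F1 \is a fin_num by apply: fin => z /F1B /BT.
have fA1 : mu A1 \is a fin_num by apply: fin => z /A1B /BT.
have tr1 : (0 <= t / r <= 1)%R.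
  by rewrite divr_ge0 ?(ltW t0) ?(ltW r0)//= ler_pdivrMr// mul1r.
have CPC : (1 <= CP * Cmu ^+ 2)%R by rewrite mulr_ege1.
have c2E : (c2 * (8 * CP * Cmu ^+ 2) = c1)%R by rewrite /c2 divfK// -mulrA gt_eqF//; lra.
have c20 : (0 < c2)%R by rewrite /c2 divr_gt0// -mulrA; lra.
(* A point with [w < 1] is not a dense point, so it serves as its own witness for membership in the
   layer. *)
have [hF1|hF1] := leP (c1 / 2 * b)%:E (mu F1).
  apply: (@le_trans _ _ (mu F1)).
    apply: le_trans hF1; rewrite BE -EFinM lee_fin ler_wpM2r ?(ltW b0)//.
    apply: (@le_trans _ _ c2); first by rewrite ler_piMr ?(ltW c20)//; case/andP: tr1.
    have : (c2 <= c2 * (CP * Cmu ^+ 2))%R by rewrite ler_peMr// ltW.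
    by move: c2E c20; clearbody c2; lra.
  apply: le_outer_measure => z [[Ez Bz] wz]; split.
    split => //; exists z; last by apply: ballxx; rewrite mulr_gt0.
    by move=> /w1 wz1; rewrite /= wz1 ltxx in wz.
  by move: (BT _ Bz); apply: le_ball; rewrite lerDl mulr_ge0// ltW.
have hA1 : (c1 / 2 * b)%:E <= mu A1.
  have : mu (E `&` B) <= mu A1 + mu F1.
    apply: le_trans (outer_measureU2 _ _ _); apply: le_outer_measure => z Bz.
    by have [wz|wz] := pselect (w z < 1)%R; [right|left].
  move=> /(le_trans dE); move: hF1; rewrite -/B BE -(fineK fF1) -(fineK fA1).
  by rewrite -!EFinM -EFinD !lee_fin lte_fin; lra.
have wE0 z : A0 z -> w z = 0%R.
  move=> [_ /negP]; rewrite -leNgt => wz; apply/eqP; rewrite eq_le wz.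
  by case/andP: (w01 z).
have wE1 z : A1 z -> w z = 1%R.
  move=> [_ /negP]; rewrite -leNgt => wz; apply/eqP; rewrite eq_le wz andbT.
  by case/andP: (w01 z).
pose a := average mu B (EFin \o w).
have := oscillation_ge a mB mA0 mA1 A0B A1B wE0 wE1 hA0 hA1.
set J := integral _ _ _ => hJ.
have := poinc x r r0 _ _ (lipschitz_locally_integrable bmu dmu t0 wlip w01)
  (cutoff_upper_gradient t0 w01 w1 w0 wlip).
set O := \bigcup_(y in _) _.
have mO : mu.-cara.-measurable O.
  by apply: open_caratheodory => //; apply: bigcup_open => y _; exact: open_metric_ball.
have intg : \int[cara_measure mu]_(y in T) (t^-1 * \1_O y)%:E = t^-1%:E * mu (O `&` T).
  under eq_integral do rewrite EFinM.
  rewrite ge0_integralZl//.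
  - by rewrite integral_indic.
  - by apply/measurable_EFinP; exact: measurable_indic.
  - by rewrite lee_fin invr_ge0 ltW.
have fO : mu (O `&` T) \is a fin_num by apply: fin; exact: subIsetr.
have fL : mu (L `&` ball x (tauP * r + 4 * t)) \is a fin_num.
  exact: (subball_measure_fin dmu (@subIsetr _ _ _)).
rewrite -[average _ (ball x r) _]/(J / mu B) /average -/T intg BE TE !inver !gt_eqF//.
have := measure_transition x (tauP * r) t0 (ltW c0) cC.
rewrite -/O -/L -/T -(fineK fO) -(fineK fL).
set o := fine (mu (O `&` T)); set l := fine _.
rewrite -!EFinM !lee_fin => hol.
have {}hJ : (c1 / 4)%:E <= J * b^-1%:E.
  by rewrite lee_pdivlMr// -EFinM; apply: le_trans hJ; rewrite lee_fin; lra.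
move=> /(le_trans hJ); rewrite lee_fin => hc.
have {}hc : (c1 / 4 * (t * m) <= CP * r * o)%R.
  have -> : (CP * r * o = CP * r * (t^-1 * o / m) * (t * m))%R.
    by field; rewrite !gt_eqF.
  by rewrite ler_wpM2r// mulr_ge0// ltW.
have CP0 : (0 < CP)%R by exact: lt_le_trans CP1.
have Cgt0 : (0 < Cmu)%R by exact: lt_le_trans C1.
(* The 8 in [c2] is the 4 of the oscillation bound times the 2 of [measure_transition]. *)
have {}hc : (c2 * (t * m) <= r * l)%R.
  rewrite -(ler_pM2l (_ : 0 < 2 * CP * Cmu ^+ 2)%R) ?mulr_gt0//.
  have : (CP * r * o <= CP * r * (2 * Cmu ^+ 2 * l))%R.
    by rewrite ler_wpM2l// mulr_ge0// ltW.
  by move: hc; rewrite -c2E; lra.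
apply: (@le_trans _ _ (c2 * (t / r) * m)%R).
  by rewrite ler_wpM2l// mulr_ge0 ?(ltW c20)//; case/andP: tr1.
rewrite (_ : c2 * (t / r) * m = c2 * (t * m) / r)%R; last by ring.
by rewrite ler_pdivrMr// [(l * r)%R]mulrC.
Qed.

End boundary_layer.

(** * Lower bounds for the fractional perimeter *)

(** With ratio at least 4/3, [4 * q ^+ m] plus the next term [q ^+ m.+1] is at most
    [4 * q ^+ m.+1]. *)
Lemma sum_geometric_last (R : realType) (q : R) m : 4 <= 3 * q ->
  \sum_(j < m.+1) q ^+ j <= 4 * q ^+ m.
Proof.
move=> q34; have q0 : 0 <= q by lra.
elim: m => [|m ih]; first by rewrite big_ord1 expr0; lra.
rewrite big_ord_recr/=; have : 4 * q ^+ m <= 3 * q ^+ m.+1.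
  by rewrite exprS mulrA ler_wpM2r// exprn_ge0.
move: ih; lra.
Qed.

(* For [theta < 1/2] a single scale suffices; otherwise [2 `^ theta] stays away
   from 1 and enough scales are needed to produce the factor [(1 - theta)^-1]. *)
Lemma dyadic_scales (R : realType) (theta : R) : 0 < theta -> theta < 1 ->
  exists n : nat, (forall m : nat, (m < n)%N ->
      \sum_(j < m.+1) (2 `^ theta) ^+ j <= 4 * (2 `^ theta) ^+ m) /\
    (2 * (1 - theta))^-1 <= \sum_(j < n) (2 `^ theta / 2) ^+ j.
Proof.
move=> th0 th1; have [th2|th2] := ltP theta 2^-1.
  exists 1%N; split; first by case=> // _; rewrite big_ord1 !expr0; lra.
  by rewrite big_ord1 expr0 invf_le1; lra.
set q := 2 `^ theta; set p := q / 2.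
have q34 : 4 <= 3 * q.
  have q2 : 2 <= q ^+ 2.
    rewrite -powR_mulrn ?powR_ge0// -powRrM -[leLHS]powRr1//.
    by rewrite ler_powR; lra.
  by have : 0 < q by [rewrite powR_gt0]; move: q2; rewrite expr2; nra.
have pE : p = 2 `^ (theta - 1) by rewrite powRB ?powRr1// pnatr_eq0 implybT.
have p1 : p < 1.
  rewrite pE /powR pnatr_eq0/= -[ltRHS]expR0 ltr_expR nmulr_rlt0 ?subr_lt0//.
  by rewrite ln_gt0// ltr1n.
have p0 : 0 < p by rewrite divr_gt0// powR_gt0.
(* The exponential lies above its tangent at 0 and [ln 2 <= 1], so [1 - p <= 1 - theta]; once
   [p ^+ n <= 1/2], the sum is at least [1 / (2 * (1 - theta))]. *)
have ptheta : theta <= p.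
  rewrite pE /powR pnatr_eq0/=; apply: le_trans (expR_ge1Dx _).
  have : ln 2 <= 1 :> R by have := @le_ln1Dx R 1; apply; lra.
  have : 0 <= ln 2 :> R by rewrite ln_ge0// ler1n.
  by nra.
have [n pn] : exists n, p ^+ n <= 2^-1.
  have absp : `|p| < 1 by rewrite ger0_norm// ltW.
  have /cvgrPdist_le/(_ 2^-1) := cvg_expr absp.
  rewrite invr_gt0 ltr0n => /(_ isT)[n _ /(_ n (leqnn n))/=].
  by rewrite sub0r normrN ger0_norm ?exprn_ge0 ?(ltW p0)//; exists n.
exists n; split; first by move=> m _; exact: sum_geometric_last.
have := subrX1 p n; set S := \sum_(_ < _) _ => pnS.
rewrite -[leLHS]mul1r ler_pdivrMr; last by lra.
have S0 : 0 <= S by apply: sumr_ge0 => i _; rewrite exprn_ge0// ltW.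
have : S * (1 - p) <= S * (1 - theta) by rewrite ler_wpM2l//; lra.
by move: pnS pn; lra.
Qed.

(* If the last active scale is [m] then the sum is at most the full geometric
   sum up to [m]. *)
Lemma sum_active_scales_le (R : realType) (a K q : R) (b : nat -> bool) n
    (M : \bar R) :
  0 <= a -> 0 <= q -> (0 <= M)%E ->
  (forall m, (m < n)%N -> \sum_(j < m.+1) q ^+ j <= K * q ^+ m) ->
  (forall m, (m < n)%N -> b m -> ((a * K * q ^+ m)%:E <= M)%E) ->
  ((\sum_(j < n) a * q ^+ j * (b j)%:R)%:E <= M)%E.
Proof.
move=> a0 q0 M0; elim: n => [|n ih] hK hb; first by rewrite big_ord0.
rewrite big_ord_recr/=; have [bn|bn] := boolP (b n); last first.
  rewrite mulr0 addr0; apply: ih => m mn; first by apply: hK; exact: ltnW.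
  by apply: hb; exact: ltnW.
apply: le_trans (hb n (leqnn _) bn); rewrite lee_fin mulr1.
have -> : a * K * q ^+ n = a * (K * q ^+ n) by rewrite mulrA.
apply: (@le_trans _ _ (a * \sum_(j < n.+1) q ^+ j)); last by rewrite ler_wpM2l// hK.
rewrite big_ord_recr/= mulrDr lerD2r mulr_sumr ler_sum// => j _.
by rewrite ler_piMr ?mulr_ge0 ?exprn_ge0// lern1 leq_b1.
Qed.

Lemma powR_dyadic (R : realType) (rho theta : R) (j : nat) : 0 <= rho ->
  (2 ^- j * rho) `^ (- theta) = rho `^ (- theta) * (2 `^ theta) ^+ j.
Proof.
move=> rho0; rewrite powRM ?invr_ge0 ?exprn_ge0// mulrC; congr (_ * _).
rewrite -(@powR_mulrn _ 2 j)// -powRN -powRrM mulrNN -powR_mulrn ?powR_ge0//.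
rewrite -powRrM.
by rewrite [theta * _]mulrC.
Qed.

Section perimeter_lower_bound.
Context (R : realType) (X : pointedMetricType R).
Variable mu : {outer_measure set X -> \bar R}.
Hypothesis bmu : borel_regular mu.
Variable Cmu : R.
Hypothesis dmu : doubling mu Cmu.
Variables E Omega : set X.
Hypothesis mE : mu.-cara.-measurable E.
Hypothesis mOmega : mu.-cara.-measurable Omega.
Local Open Scope ereal_scope.
Implicit Types (x y z : X) (r s t : R).

Let kernel theta x y : \bar R :=
  2%:E / ((mdist x y `^ theta)%:E *
    (mu (ball x (mdist x y)) + mu (ball y (mdist x y)))).

Let kernel_ge0 theta x y : 0 <= kernel theta x y.
Proof.
rewrite mule_ge0 ?lee_fin// inve_ge0 mule_ge0 ?lee_fin ?powR_ge0//.
by rewrite adde_ge0 ?outer_measure_ge0.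
Qed.

(** A layer point is within [5 * t] of some [x'] such that the complement has density at least [c]
    in [ball x' (4 * t)]; that portion lies within [9 * t] of [z], where the kernel has a uniform
    lower bound. *)
Lemma boundary_layer_kernel theta c t z : (0 < theta)%R -> (theta < 1)%R ->
  (0 < t)%R -> (0 <= c)%R -> boundary_layer mu E c t z -> ball z (9 * t) `<=` Omega ->
  (c / (9 * Cmu ^+ 3) * t `^ (- theta))%:E <=
  \int[cara_measure mu]_(y in Omega `\` E) kernel theta z y.
Proof.
move=> th0 th1 t0 c0 [Ez [x' Gx' /ballP x'z]] zO.
have C1 := doubling_ge1 dmu; have Cgt0 : (0 < Cmu)%R by exact: lt_le_trans C1.
have C30 : (0 < Cmu ^+ 3)%R by rewrite exprn_gt0.
have t40 : (0 < 4 * t)%R by rewrite mulr_gt0.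
pose B := ball x' (4 * t).
have fB : mu B \is a fin_num by exact: (subball_measure_fin dmu (@subset_refl _ _)).
pose m := fine (mu B).
have m0 : (0 < m)%R by rewrite fine_gt0// (ball_measure_gt0 dmu)//= -ge0_fin_numE.
have BE : mu B = m%:E by rewrite fineK.
have BEm : c%:E * mu B <= mu (B `\` E) by move: Gx' => /negP; rewrite -leNgt.
have Bz y : B y -> (mdist z y < 9 * t)%R.
  by move=> /ballP x'y; have := metric_triangle z x' y; rewrite (metric_sym z x'); lra.
pose P := ((9 * t) `^ theta)%R.
have t90 : (0 < 9 * t)%R by rewrite mulr_gt0.
have P0 : (0 < P)%R by exact: powR_gt0.
pose a := (P * Cmu ^+ 3 * m)^-1%R.
have a0 : (0 < a)%R by rewrite invr_gt0 !mulr_gt0.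
apply: (@le_trans _ _ (a%:E * mu (B `\` E))).
  apply: (@le_trans _ _ (a%:E * (c%:E * mu B))); last first.
    by rewrite lee_wpmul2l// lee_fin ltW.
  rewrite BE -!EFinM lee_fin.
  have -> : (a * (c * m) = c / Cmu ^+ 3 * P^-1)%R.
    by rewrite /a; field; rewrite !gt_eqF.
  have -> : (c / (9 * Cmu ^+ 3) * t `^ (- theta) =
      c / Cmu ^+ 3 * (9 * t `^ theta)^-1)%R.
    by rewrite powRN; field; rewrite !gt_eqF ?powR_gt0.
  rewrite ler_wpM2l ?divr_ge0 ?(ltW C30)// lef_pV2 ?posrE ?mulr_gt0 ?powR_gt0//.
  (* As [theta < 1], the power of 9 is at most 9, the factor in the constant. *)
  rewrite /P powRM// ?(ltW t0)// ler_wpM2r ?powR_ge0//.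
  by rewrite -[leRHS]powRr1// ler_powR; lra.
apply: (@cst_indic_le_integral _ (caratheodory_type mu) _ (cara_measure mu)).
- exact: measurableD.
- by apply: measurableD => //; exact: ball_caratheodory.
- by move=> y [By Ey]; split => //; apply: zO; apply/ballP; exact: Bz.
- exact: ltW.
- by move=> y _; exact: kernel_ge0.
move=> y [By Ey]; rewrite /kernel; set d := mdist z y.
have d0 : (0 < d)%R by rewrite mdist_gt0; apply/eqP => zy; apply: Ey; rewrite -zy.
have d9 : (d < 9 * t)%R by exact: Bz.
have fz : mu (ball z d) \is a fin_num.
  exact: (subball_measure_fin dmu (@subset_refl _ _)).
have fy : mu (ball y d) \is a fin_num.
  exact: (subball_measure_fin dmu (@subset_refl _ _)).
have hz : mu (ball z d) <= (Cmu ^+ 3)%:E * mu B.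
  by apply: (subball_doubling dmu) => //; rewrite !exprS expr0; lra.
have hy : mu (ball y d) <= (Cmu ^+ 3)%:E * mu B.
  by apply: (subball_doubling dmu) => //; move/ballP: By; rewrite !exprS expr0; lra.
have gz := ball_measure_gt0 dmu z d0.
move: hz hy gz (outer_measure_ge0 mu (ball y d)).
rewrite BE -(fineK fz) -(fineK fy) -EFinM !lee_fin lte_fin.
set u := fine _; set v := fine _ => hu hv u0 v0.
have dP : (d `^ theta <= P)%R.
  by apply: ge0_ler_powR; rewrite ?nnegrE ?(ltW th0) ?(ltW d0) ?(ltW d9)// mulr_ge0// ltW.
have dt0 : (0 < d `^ theta)%R by rewrite powR_gt0.
have uv0 : (0 < u + v)%R by lra.
rewrite -EFinD -EFinM inver gt_eqF ?mulr_gt0// -EFinM lee_fin.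
rewrite /a -[leLHS]mul1r ler_pdivrMr ?mulr_gt0// mulrAC ler_pdivlMr ?mulr_gt0// mul1r.
apply: (@le_trans _ _ (P * (2 * (Cmu ^+ 3 * m)))%R); last by lra.
by rewrite ler_pM ?(ltW dt0) ?(ltW uv0)//; lra.
Qed.

(** The inner integral is bounded below by a sum over balls and scales. At a given point only one
    ball contributes, by disjointness, and its active scales are dominated by the finest one.
    Integrating over the layers gives each ball a sum of powers of [q / 2], of size at least
    [1 / (2 * (1 - theta))]. In [lam], [2 * tauP] is the Poincare dilation of the doubled ball and 4
    bounds the term [4 * t]. *)
Lemma perimeter_ge_sum (CP tauP c1 theta : R) (s : seq nat) (ctr : nat -> X)
    (rho : nat -> R) (lam := (2 * tauP + 4)%R) (c := (c1 / (2 * Cmu ^+ 4))%R)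
    (c2 := (c1 / (8 * CP * Cmu ^+ 2))%R) (c3 := (c / (9 * Cmu ^+ 3))%R) :
  poincare11 mu CP tauP -> (0 < theta)%R -> (theta < 1)%R -> (0 < c1)%R ->
  uniq s -> E `<=` Omega -> {in s, forall i, 0 < rho i}%R ->
  {in s, forall i, c1%:E * mu (ball (ctr i) (2 * rho i)) <=
                   mu (E `&` ball (ctr i) (2 * rho i))} ->
  {in s, forall i, c1%:E * mu (ball (ctr i) (2 * rho i)) <=
                   mu (ball (ctr i) (2 * rho i) `\` E)} ->
  {in s &, forall i j,
    ball (ctr i) (lam * rho i) `&` ball (ctr j) (lam * rho j) !=set0 -> i = j} ->
  {in s, forall i z, E z -> ball z (9 * rho i) `<=` Omega} ->
  \sum_(i <- s) mu (ball (ctr i) (rho i)) / (rho i `^ theta)%:E <=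
  (16 / (c2 * c3) * (1 - theta))%:E * theta_perimeter mu theta E Omega.
Proof.
move=> poinc th0 th1 c10 us EO rho0 dE dCE disj EOm.
have [CP1 tauP1 _] := poinc.
have CP0 : (0 < CP)%R by exact: lt_le_trans CP1.
have C1 := doubling_ge1 dmu; have Cgt0 : (0 < Cmu)%R by exact: lt_le_trans C1.
have Cn n : (0 < Cmu ^+ n)%R by exact: exprn_gt0.
have c0 : (0 < c)%R by rewrite divr_gt0// mulr_gt0.
have c20 : (0 < c2)%R by rewrite divr_gt0// !mulr_gt0.
have c30 : (0 < c3)%R by rewrite divr_gt0// mulr_gt0.
have [n [hn1 hn2]] := dyadic_scales th0 th1.
set q := (2 `^ theta)%R in hn1 hn2.
have q0 : (0 < q)%R by exact: powR_gt0.
pose t (ij : nat * nat) := (2 ^- ij.2 * rho ij.1)%R.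
pose A ij := boundary_layer mu E c (t ij) `&` ball (ctr ij.1) (lam * rho ij.1).
(* The division by 4 absorbs the constant of the geometric sum. *)
pose a i := (c3 / 4 * rho i `^ (- theta))%R.
have a0 i : (0 <= a i)%R by rewrite mulr_ge0 ?powR_ge0// divr_ge0// ltW.
pose cf (ij : nat * nat) := (a ij.1 * q ^+ ij.2)%R.
have t0 i j : i \in s -> (0 < t (i, j))%R.
  by move=> si; rewrite mulr_gt0 ?rho0// invr_gt0 exprn_gt0.
have trho i j : i \in s -> (t (i, j) <= rho i)%R.
  move=> si; rewrite /t/= ler_piMl ?(ltW (rho0 _ si))// invf_le1 ?exprn_gt0//.
  by rewrite exprn_ege1// ler1n.
have mA ij : mu.-cara.-measurable (A ij).
  by apply: measurableI; [exact: measurable_boundary_layer|exact: ball_caratheodory].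
have AD ij : A ij `<=` Omega `&` E by move=> z [[Ez _] _]; split => //; exact: EO.
have pointwise z : (Omega `&` E) z ->
    (\sum_(ij <- [seq (i, j) | i <- s, j <- index_iota 0 n]) cf ij * \1_(A ij) z)%:E <=
    \int[cara_measure mu]_(y in Omega `\` E) kernel theta z y.
  move=> [Oz Ez]; rewrite big_allpairs; under eq_bigr do rewrite big_mkord.
  have J0 : 0 <= \int[cara_measure mu]_(y in Omega `\` E) kernel theta z y.
    by apply: integral_ge0 => y _; exact: kernel_ge0.
  apply: sum_single_le => //.
    have inball i : \big[+%R/0%R]_(j < n) (cf (i, val j) * \1_(A (i, val j)) z)%R != 0%R ->
        ball (ctr i) (lam * rho i) z.
      apply: contra_neqP => nb; apply: big1 => j _.
      by rewrite indicE memNset ?mulr0// => -[_].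
    move=> i j si sj /inball iz /inball jz; apply: disj => //.
    by exists z.
  move=> i si; under eq_bigr do rewrite indicE.
  apply: (@sum_active_scales_le _ (a i) 4 q (fun j => z \in A (i, j))) => //.
  - exact: ltW.
  move=> m mn /set_mem[Lz _].
  apply: le_trans (boundary_layer_kernel th0 th1 (t0 i m si) (ltW c0) Lz _); last first.
    apply: subset_trans (EOm i si z Ez); apply: le_ball.
    by rewrite ler_pM2l// trho.
  rewrite lee_fin /t/= powR_dyadic ?(ltW (rho0 _ si))// /a -/c3 -/q; lra.
(* The 16 is the 4 in [a], the 2 of the doubled radius in [t / (2 * rho)], and the 2 from
   [dyadic_scales]. *)
have scale i : i \in s ->
    (c2 * c3 / 16 / (1 - theta) * (fine (mu (ball (ctr i) (rho i))) / rho i `^ theta))%:E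
    <= \sum_(j < n) (cf (i, val j))%:E * mu (A (i, val j) `&` (Omega `&` E)).
  move=> si; have r0 := rho0 i si; have r20 : (0 < 2 * rho i)%R by rewrite mulr_gt0.
  set B := ball (ctr i) (rho i); pose b := fine (mu B).
  have fB : mu B \is a fin_num by exact: (subball_measure_fin dmu (@subset_refl _ _)).
  have b0 : (0 <= b)%R by rewrite fine_ge0// outer_measure_ge0.
  apply: (@le_trans _ _
      (\sum_(j < n) (a i * (c2 / 2) * b * (q / 2) ^+ j)%:E)).
    rewrite sumEFin lee_fin -mulr_sumr -/B -/b.
    apply: (@le_trans _ _ (a i * (c2 / 2) * b * (2 * (1 - theta))^-1)%R); last first.
      have c2h : (0 <= c2 / 2)%R by rewrite divr_ge0// ltW.
      by rewrite ler_wpM2l//; apply: mulr_ge0 => //; exact: mulr_ge0.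
    rewrite /a powRN le_eqVlt; apply/orP; left; apply/eqP; field.
    by rewrite subr_eq0 gt_eqF//= gt_eqF// powR_gt0.
  apply: lee_sum => j _; rewrite (setIidl (AD _)).
  apply: (@le_trans _ _ ((cf (i, val j))%:E * ((c2 / 2 / 2 ^+ j)%:E * mu B))).
    rewrite -(fineK fB) -!EFinM lee_fin /cf/= -/b expr_div_n le_eqVlt; apply/orP; left.
    by apply/eqP; field; rewrite expf_neq0.
  have cf0 : 0 <= (cf (i, val j))%:E.
    by rewrite lee_fin; exact: mulr_ge0 (a0 i) (exprn_ge0 _ (ltW q0)).
  apply: lee_wpmul2l => //.
  have tr : (t (i, val j) <= 2 * rho i)%R by apply: le_trans (trho _ _ si) _; lra.
  have := boundary_layer_measure bmu dmu mE poinc (t0 i j si) tr c10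
    (dE i si) (dCE i si) erefl.
  rewrite -/c -/c2 => h.
  apply: (@le_trans _ _ (mu (boundary_layer mu E c (t (i, val j)) `&`
    ball (ctr i) (tauP * (2 * rho i) + 4 * t (i, val j))))); last first.
    apply: le_outer_measure; apply: setIS; apply: le_ball.
    by have := trho i j si; rewrite /lam; lra.
  apply: le_trans h.
  apply: (@le_trans _ _ ((c2 / 2 / 2 ^+ j)%:E * mu (ball (ctr i) (2 * rho i)))).
    have c2j : 0 <= (c2 / 2 / 2 ^+ j)%:E.
      by rewrite lee_fin divr_ge0 ?exprn_ge0// divr_ge0// ltW.
    apply: lee_wpmul2l => //.
    by apply/le_outer_measure/le_ball; lra.
  rewrite lee_wpmul2r ?outer_measure_ge0// lee_fin /t/= le_eqVlt; apply/orP; left.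
  by apply/eqP; field; rewrite expf_neq0//= gt_eqF.
have th10 : (0 < 1 - theta)%R by rewrite subr_gt0.
have := sum_indic_le_integral (cara_measure mu) (measurableI _ _ mOmega mE) mA
  (fun ij => mulr_ge0 (a0 ij.1) (exprn_ge0 ij.2 (ltW q0))) pointwise.
rewrite big_allpairs => hP.
have -> : (16 / (c2 * c3) * (1 - theta) = (c2 * c3 / 16 / (1 - theta))^-1)%R.
  by field; rewrite !gt_eqF.
have k0 : (0 < c2 * c3 / 16 / (1 - theta))%R.
  by rewrite divr_gt0// divr_gt0// mulr_gt0.
rewrite lee_pdivlMl//; apply: le_trans hP.
rewrite (_ : (\sum_(i <- s) _)%R = (\sum_(i <- s)
    (fine (mu (ball (ctr i) (rho i))) / rho i `^ theta))%R%:E); last first.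
  rewrite -sumEFin [LHS]big_seq [RHS]big_seq; apply: eq_bigr => i si.
  have fB : mu (ball (ctr i) (rho i)) \is a fin_num.
    exact: (subball_measure_fin dmu (@subset_refl _ _)).
  by rewrite inver gt_eqF ?powR_gt0 ?rho0// -{1}(fineK fB).
rewrite -EFinM mulr_sumr -sumEFin [leLHS]big_seq [leRHS]big_seq; apply: lee_sum => i si.
by apply: le_trans (scale i si) _; rewrite big_mkord.
Qed.

End perimeter_lower_bound.

(** * Stopping balls *)

Section stopping_time.
Context (R : realType) (X : pointedMetricType R).
Variable mu : {outer_measure set X -> \bar R}.
Variable Cmu : R.
Hypothesis dmu : doubling mu Cmu.
Variables (E : set X) (x0 : X) (r0 kappa : R).
Hypothesis r0_gt0 : 0 < r0.
Hypothesis EB : E `<=` ball x0 r0.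
Hypothesis kappa0 : 0 < kappa.
Hypothesis kappa1 : kappa < 1.
Local Open Scope ereal_scope.
Hypothesis kappaE : mu E <= kappa%:E * mu (ball x0 r0).

Let gam := ((2 * Cmu ^+ 2)^-1)%R.

Let dyadic_gt0 k : (0 < 2 ^- k * r0)%R.
Proof. by rewrite mulr_gt0// invr_gt0 exprn_gt0. Qed.

(** [E] is already dense in the half ball, where the stopping rule applies; its complement is large
    because the doubled ball belongs to a coarser scale. *)
Lemma stopping_ball_density x k : E x ->
  gam%:E * mu (ball x (2 ^- k * r0)) < mu (E `&` ball x (2 ^- k * r0)) ->
  (forall j, (j < k)%N ->
    mu (E `&` ball x (2 ^- j * r0)) <= gam%:E * mu (ball x (2 ^- j * r0))) ->
  ((1 - kappa) / (2 * Cmu ^+ 3))%:E * mu (ball x (2 * (2 ^- k * r0))) <=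
    mu (E `&` ball x (2 * (2 ^- k * r0))) /\
  ((1 - kappa) / (2 * Cmu ^+ 3))%:E * mu (ball x (2 * (2 ^- k * r0))) <=
    mu (ball x (2 * (2 ^- k * r0)) `\` E).
Proof.
move=> Ex dk dj; set rho := (2 ^- k * r0)%R; have rho0 : (0 < rho)%R := dyadic_gt0 k.
set B := ball x (2 * rho).
have C1 := doubling_ge1 dmu; have Cgt0 : (0 < Cmu)%R by exact: lt_le_trans C1.
have Cn n : (0 < Cmu ^+ n)%R by exact: exprn_gt0.
have Cn1 n : (1 <= Cmu ^+ n)%R by exact: exprn_ege1.
have gam0 : (0 < gam)%R by rewrite invr_gt0 mulr_gt0.
have gam2 : (gam <= 2^-1)%R by rewrite lef_pV2 ?posrE ?mulr_gt0// ler_peMr.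
have fin A y s : A `<=` ball y s -> mu A \is a fin_num by exact: (subball_measure_fin dmu).
have fB : mu B \is a fin_num by exact: (fin _ _ _ (@subset_refl _ _)).
have fBE : mu (B `\` E) \is a fin_num by exact: (fin _ _ _ (@subDsetl _ _ _)).
have fEB : mu (E `&` B) \is a fin_num by exact: (fin _ _ _ (@subIsetr _ _ _)).
pose b := fine (mu B); have b0 : (0 <= b)%R by rewrite fine_ge0// outer_measure_ge0.
set c1 : R := ((1 - kappa) / _)%R.
have c1E : (c1 * (2 * Cmu ^+ 3) = 1 - kappa)%R by rewrite divfK// gt_eqF// mulr_gt0.
have c10 : (0 < c1)%R by rewrite divr_gt0 ?mulr_gt0// subr_gt0.
split.
  apply: (@le_trans _ _ (gam%:E * mu (ball x rho))); last first.
    apply: le_trans (ltW dk) _; apply: le_outer_measure; apply: setIS.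
    by apply: le_ball; rewrite -/rho; lra.
  have fr : mu (ball x rho) \is a fin_num by exact: (fin _ _ _ (@subset_refl _ _)).
  have := ball_doubling dmu 1 x rho0; rewrite !expr1 -/B.
  rewrite -(fineK fB) -(fineK fr) -!EFinM !lee_fin -/b; set m := fine _ => bm.
  apply: (@le_trans _ _ (gam / Cmu * b)%R); last first.
    by rewrite -mulrA ler_pM2l// mulrC ler_pdivrMr// mulrC.
  apply: ler_wpM2r => //.
  have -> : (gam / Cmu = (2 * Cmu ^+ 3)^-1)%R by rewrite /gam; field; rewrite gt_eqF.
  have C30 : (0 < 2 * Cmu ^+ 3)%R by rewrite mulr_gt0.
  by rewrite /c1 ler_piMl ?invr_ge0 ?(ltW C30)// lerBlDr lerDl ltW.
(* For [k = 0] no coarser ball was tested; the doubled ball contains [ball x0 r0], and [kappaE]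
   supplies the complement there. *)
have [k0|k0] := posnP k.
  have rhoE : rho = r0 by rewrite /rho k0 expr0 invr1 mul1r.
  have /ballP x0x := EB Ex.
  have fB0 : mu (ball x0 r0) \is a fin_num by exact: (fin _ _ _ (@subset_refl _ _)).
  have fE : mu E \is a fin_num by exact: (fin _ _ _ EB).
  have h1 : mu B <= (Cmu ^+ 2)%:E * mu (ball x0 r0).
    by apply: (subball_doubling dmu) => //; rewrite rhoE expr2; lra.
  have h2 : mu (ball x0 r0) <= mu E + mu (B `\` E).
    apply: le_trans (outer_measureU2 _ _ _); apply: le_outer_measure => z x0z.
    have [Ez|Ez] := pselect (E z); [by left|right; split => //].
    by move: x0z; apply: ball_subset; rewrite metric_sym rhoE; lra.
  move: h1 h2 kappaE; rewrite -(fineK fB) -(fineK fB0) -(fineK fE) -(fineK fBE).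
  rewrite -!EFinM -EFinD !lee_fin -/b; set m := fine _; set d := fine (mu (_ `\` _)).
  have m0 : (0 <= m)%R by rewrite fine_ge0// outer_measure_ge0.
  move=> h1 h2 h3; apply: (@le_trans _ _ ((1 - kappa) * m)%R); last by lra.
  apply: (@le_trans _ _ (c1 * (Cmu ^+ 2 * m))%R); first by rewrite ler_wpM2l// ltW.
  rewrite mulrA; apply: ler_wpM2r => //; rewrite -c1E; apply: ler_wpM2l; first exact: ltW.
  rewrite exprS; have : (Cmu ^+ 2 <= Cmu * Cmu ^+ 2)%R by rewrite ler_peMl// ltW.
  by have := Cn 2%N; lra.
(* The doubled ball is the preceding dyadic ball, where the density of [E] is at most
   [gam <= 1/2]. *)
have BE : B = ball x (2 ^- k.-1 * r0).
  rewrite /B /rho -[in LHS](prednK k0) exprS invfM; congr (ball _ _).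
  by field; rewrite expf_neq0.
have := dj k.-1 (ltac:(by rewrite prednK)); rewrite -BE.
have : mu B <= mu (E `&` B) + mu (B `\` E).
  apply: le_trans (outer_measureU2 _ _ _); apply: le_outer_measure => z Bz.
  by have [Ez|Ez] := pselect (E z); [left|right].
rewrite -(fineK fB) -(fineK fBE) -(fineK fEB) -!EFinM -EFinD !lee_fin -/b => h1 h2.
have h3 : (gam * b <= 2^-1 * b)%R by exact: ler_wpM2r.
have h4 : (c1 * b <= 2^-1 * b)%R.
  apply: ler_wpM2r => //; have : (c1 <= c1 * Cmu ^+ 3)%R by rewrite ler_peMr// ltW.
  by move: c1E kappa0; rewrite mulrCA; lra.
lra.
Qed.

End stopping_time.

(** * Choice of the constants and of the covering *)

Theorem proposition6p3 (R : realType) (kappa Cmu CP tauP : R)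
    (kappa_gt0 : 0 < kappa) (kappa_lt1 : kappa < 1) :
  exists tau C : R, [/\ 1 <= tau, 1 <= C &
    forall (X : completeMetricType R) (mu : {outer_measure set X -> \bar R}),
      borel_regular mu -> doubling mu Cmu -> poincare11 mu CP tauP ->
    forall (U : set X) (x0 : X) (r0 : R),
      mu.-caratheodory U -> 0 < r0 ->
      (mu (U `&` ball x0 r0) / mu (ball x0 r0) <= kappa%:E)%E ->
    exists (I : set nat) (c : nat -> X) (r : nat -> R) (Nul : set X),
      [/\ (forall i, I i -> exists Ni : nat, r i = 2 ^- Ni * r0),
          trivIset I (fun i => ball (c i) (r i)),
          Nul `<=` U /\ mu Nul = 0%E,
          U `&` ball x0 r0 `<=`
            Nul `|` \bigcup_(i in I) ball (c i) (5 * tau * r i) /\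
          \bigcup_(i in I) ball (c i) (r i) `<=` ball x0 (tau * r0) &
          forall theta : R, 0 < theta -> theta < 1 ->
            (\esum_(i in I) (mu (ball (c i) (r i)) / (r i `^ theta)%:E)
             <= (C * (1 - theta))%:E *
                theta_perimeter mu theta (U `&` ball x0 r0)
                  (ball x0 (tau * r0)))%E]].
Proof.
(* If one of the constants is below 1, the hypotheses on the space are contradictory and any [tau]
   and [C] will do. *)
have [[C1 CP1 tauP1]|nC] := pselect [/\ 1 <= Cmu, 1 <= CP & 1 <= tauP]; last first.
  exists 1, 1; split => // X mu _ [C1 _] [CP1 tauP1 _].
  by case: nC.
pose c1 : R := (1 - kappa) / (2 * Cmu ^+ 3).
pose c2 : R := c1 / (8 * CP * Cmu ^+ 2).
pose c3 : R := c1 / (2 * Cmu ^+ 4) / (9 * Cmu ^+ 3).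
pose lam : R := 2 * tauP + 4.
(* In [lam + 10], 10 places [ball z (9 * r)], with [r <= r0] and [z] in [E], inside [tau] times the
   given ball; the tripled [lam]-balls fit in the factor [5 * tau]. *)
exists (lam + 10), (Num.max 1 (16 / (c2 * c3))); split.
- by rewrite /lam; lra.
- by rewrite le_max lexx.
move=> X mu bmu dmu poinc U x0 r0 mU r0_gt0 kappaU.
set E := U `&` ball x0 r0.
have Cgt0 : 0 < Cmu by exact: lt_le_trans C1.
have c10 : 0 < c1 by rewrite divr_gt0 ?subr_gt0// mulr_gt0// exprn_gt0.
have mE : mu.-cara.-measurable E.
  by apply: measurableI => //; exact: ball_caratheodory.
have EB : E `<=` ball x0 r0 by exact: subIsetr.
have kappaE : (mu E <= kappa%:E * mu (ball x0 r0))%E.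
  have fB : mu (ball x0 r0) \is a fin_num.
    exact: (subball_measure_fin dmu (@subset_refl _ _)).
  have B0 : 0 < fine (mu (ball x0 r0)).
    by rewrite fine_gt0// (ball_measure_gt0 dmu)//= -ge0_fin_numE.
  by move: kappaU; rewrite -(fineK fB) inver gt_eqF// lee_pdivrMr.
pose gam : R := (2 * Cmu ^+ 2)^-1.
pose dense x k := (gam%:E * mu (ball x (2 ^- k * r0)) < mu (E `&` ball x (2 ^- k * r0)))%E.
pose Nul := [set x | E x /\ forall k, (mu (E `&` ball x (2 ^- k * r0)) <=
                                       gam%:E * mu (ball x (2 ^- k * r0)))%E].
have Nul0 : mu Nul = 0%E.
  apply: (weak_density bmu dmu r0_gt0 EB).
    by rewrite invr_ge0 mulr_ge0// exprn_ge0// ltW.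
  by have -> : gam * Cmu ^+ 2 = 2^-1 by rewrite /gam; field; rewrite gt_eqF.
(* The first dyadic scale at which [E] is dense, that is, the largest such ball. *)
have stop x : exists k, (E `\` Nul) x ->
    dense x k /\ forall j, (j < k)%N -> ~~ dense x j.
  have [[Ex Nx]|] := pselect ((E `\` Nul) x); last by exists 0%N.
  have exd : exists k, dense x k.
    apply: contrapT => nd; apply: Nx; split => // k; rewrite leNgt; apply/negP => dk.
    by apply: nd; exists k.
  case: (ex_minnP exd) => k dk mink; exists k => _; split => // j jk.
  by apply/negP => /mink; rewrite leqNgt jk.
have {stop}[k stop] := choice stop.
pose rr x := 2 ^- k x * r0.
have rr0 x : 0 < rr x by rewrite mulr_gt0// invr_gt0 exprn_gt0.
have rr_le x : rr x <= r0.
  rewrite /rr ler_piMl ?(ltW r0_gt0)// invf_le1 ?exprn_gt0//.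
  by rewrite exprn_ege1// ler1n.
have lam0 : 0 < lam by rewrite /lam; lra.
have rr_k x y : (k y <= k x)%N -> lam * rr x <= lam * rr y.
  move=> kyx; rewrite ler_pM2l// ler_wpM2r ?(ltW r0_gt0)//.
  by rewrite lef_pV2 ?posrE ?exprn_gt0// ler_weXn2l// ler1n.
have x0E x : E x -> mdist x0 x < r0 by move=> /EB /ballP.
have DB x : (E `\` Nul) x -> ball x (lam * rr x) `<=` ball x0 ((lam + 1) * r0).
  move=> [/x0E x0x _]; apply: ball_subset.
  by have : lam * rr x <= lam * r0 by [rewrite ler_pM2l]; lra.
(* The covering lemma is applied to the [lam]-enlarged balls, since the perimeter estimate needs
   those to be disjoint. *)
have [I [ctr [ID tI cov]]] := vitali_covering bmu dmu rr_k
  (fun x => mulr_gt0 lam0 (rr0 x)) DB.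
exists I, ctr, (rr \o ctr), Nul; split.
- by move=> i _; exists (k (ctr i)).
- move=> i j Ii Ij [z [iz jz]]; apply: tI => //; exists z.
  by split; [move: iz|move: jz]; apply: le_ball; rewrite ler_peMl ?(ltW (rr0 _))//;
    rewrite /lam; lra.
- by split => // x [[]].
- split.
    move=> x Ex; have [Nx|Nx] := pselect (Nul x); first by left.
    right; have [i Ii ci] := cov x (conj Ex Nx); exists i => //.
    have : ball x (lam * rr x) x by apply: ballxx; rewrite mulr_gt0.
    move=> /ci; apply: le_ball; have := mulr_gt0 lam0 (rr0 (ctr i)).
    by have := rr0 (ctr i); rewrite /=; lra.
  apply: bigcup_sub => i /ID[/x0E x0i _]; apply: ball_subset.
  have := rr_le (ctr i); rewrite /=.
  by have := mulr_gt0 lam0 r0_gt0; lra.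
(* The sum over [I] is a supremum of finite sums, so the estimate for finite lists suffices. *)
move=> theta th0 th1; apply: ge_ereal_sup => _ /= [A [finA AI] <-].
have sA i : i \in fset_set A -> I i by rewrite in_fset_set// => /set_mem /AI.
have lamE : {in fset_set A &, forall i j, ball (ctr i) (lam * rr (ctr i)) `&`
    ball (ctr j) (lam * rr (ctr j)) !=set0 -> i = j}.
  by move=> i j /sA Ii /sA Ij; exact: tI.
have density i : i \in fset_set A ->
    (c1%:E * mu (ball (ctr i) (2 * rr (ctr i))) <=
      mu (E `&` ball (ctr i) (2 * rr (ctr i))))%E /\
    (c1%:E * mu (ball (ctr i) (2 * rr (ctr i))) <=
      mu (ball (ctr i) (2 * rr (ctr i)) `\` E))%E.
  move=> /sA /ID Di; have [dk dj] := stop _ Di.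
  apply: (stopping_ball_density dmu r0_gt0 EB kappa_gt0 kappa_lt1 kappaE Di.1 dk).
  by move=> j jk; rewrite leNgt; exact: dj.
rewrite fsbig_finite//=.
apply: (@le_trans _ _ ((16 / (c2 * c3) * (1 - theta))%:E *
    theta_perimeter mu theta E (ball x0 ((lam + 10) * r0)))%E).
  apply: (perimeter_ge_sum bmu dmu mE _ poinc th0 th1 c10 _ _ _ _ _ lamE).
  - exact: ball_caratheodory.
  - exact: fset_uniq.
  - apply: subset_trans EB _; apply: le_ball; rewrite ler_peMl ?(ltW r0_gt0)//.
    by rewrite /lam; lra.
  - by move=> i _; exact: rr0.
  - by move=> i /density[].
  - by move=> i /density[].
  - move=> i _ z /x0E x0z; apply: ball_subset.
    have := rr_le (ctr i); rewrite /=.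
    by have := mulr_gt0 lam0 r0_gt0; lra.
apply: lee_wpmul2r.
  apply: integral_ge0 => x _; apply: integral_ge0 => y _.
  rewrite mule_ge0 ?lee_fin// inve_ge0 mule_ge0 ?lee_fin ?powR_ge0//.
  by rewrite adde_ge0 ?outer_measure_ge0.
rewrite lee_fin ler_wpM2r ?subr_ge0 ?(ltW th1)//.
by rewrite le_max lexx orbT.
Qed.
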